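(* Let $T\in(0,\infty]$ and let $\sigma$ be an asymptotically flat metric on $\mathbb{R}^n$, $n\ge3$. Let $u_0\in C^{0,1}(\mathbb{R}^n)$ be uniformly spacelike with $u_0(x)\to0$ as $|x|\to\infty$. Let $u\in C^{2;1}(\mathbb{R}^n\times(0,T))\cap C^0(\mathbb{R}^n\times[0,T))$ be a solution of $\partial_tu=g^{ij}(\sigma,\nabla u)\,{}^\sigma\nabla^2_{ij}u$ with $u(\cdot,0)=u_0$, and suppose there is $\mu>0$ with $|\nabla u|_\sigma^2\le1-\mu$. Then for every $t\in(0,T)$, $u(x,t)\to0$ as $|x|\to\infty$. Moreover, there is a function $b\colon\mathbb{R}^n\to\mathbb{R}_+$, depending only on $u_0$ and $\sigma$, such that (i) $|u(x,t)|\le b(x)$ for all $(x,t)\in\mathbb{R}^n\times(0,T)$ and (ii) $b(x)\to0$ as $|x|\to\infty$.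
   Context: Asymptotic flatness of $\sigma$ on $\mathbb{R}^n$: $|\sigma_{ij}-\delta_{ij}|\lesssim\omega(r)$ and $|\partial\sigma_{ij}|\lesssim\omega(r)/r$ for $r=|x|$ large, with $\omega$ bounded, $\omega(r)\to0$. Uniformly spacelike: Lipschitz constant with respect to $\sigma$ at most $1-\varepsilon$ for some $\varepsilon>0$. $g^{ij}(\sigma,\nabla w)=\sigma^{ij}+\frac{\sigma^{ik}\sigma^{jl}w_kw_l}{1-\sigma^{kl}w_kw_l}$; ${}^\sigma\nabla^2$ is the Hessian of $\sigma$. *)

(* Defs.v *)
From HB Require Import structures.
From mathcomp Require Import all_boot all_order all_algebra.
From mathcomp Require Import all_classical all_reals all_analysis.
Set Implicit Arguments. Unset Strict Implicit. Unset Printing Implicit Defensive.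
Import Order.TTheory GRing.Theory Num.Theory.
Import numFieldNormedType.Exports.
Local Open Scope classical_set_scope.
Local Open Scope ring_scope.

Section Defs.
Variables (R : realType) (n : nat).

Definition evec (i : 'I_n) : 'rV[R]_n := delta_mx 0 i.

Definition enorm (x : 'rV[R]_n) : R := Num.sqrt (\sum_i x 0 i ^+ 2).

Definition pd (f : 'rV[R]_n -> R) (i : 'I_n) : 'rV[R]_n -> R :=
  fun x => derive f x (evec i).

Definition iter_pd (ks : seq 'I_n) (f : 'rV[R]_n -> R) : 'rV[R]_n -> R :=
  foldr (fun i g => pd g i) f ks.

Definition smooth (f : 'rV[R]_n -> R) : Prop :=
  forall ks : seq 'I_n,
    continuous (iter_pd ks f) /\
    forall (i : 'I_n) x, derivable (iter_pd ks f) x (evec i).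

Definition vanishes_at_infinity (f : 'rV[R]_n -> R) : Prop :=
  forall eps : R, 0 < eps ->
    exists M : R, forall x, M <= enorm x -> `|f x| < eps.

Definition riemannian_metric (sigma : 'rV[R]_n -> 'M[R]_n) : Prop :=
  (forall i j, smooth (fun x => sigma x i j)) /\
  (forall x i j, sigma x i j = sigma x j i) /\
  (forall x (v : 'rV[R]_n), v != 0 -> 0 < (v *m sigma x *m v^T) 0 0).

Definition asymptotically_flat (sigma : 'rV[R]_n -> 'M[R]_n) : Prop :=
  riemannian_metric sigma /\
  exists omega : R -> R,
    (exists B : R, forall r, `|omega r| <= B) /\
    (omega @ +oo --> 0) /\
    exists C r0 : R, forall x, r0 <= enorm x ->
      forall i j : 'I_n,
        `|sigma x i j - (i == j)%:R| <= C * omega (enorm x) /\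
        forall k : 'I_n,
          `|pd (fun y => sigma y i j) k x| <= C * omega (enorm x) / enorm x.

Definition sigma_length (sigma : 'rV[R]_n -> 'M[R]_n) (gamma : R -> 'rV[R]_n) : R :=
  (\int[lebesgue_measure]_(s in `[0, 1]%classic)
     Num.sqrt ((derive1 gamma s *m sigma (gamma s) *m (derive1 gamma s)^T) 0 0))%R.

Definition C1_curve (gamma : R -> 'rV[R]_n) : Prop :=
  (forall s, derivable gamma s 1) /\ continuous (derive1 gamma).

(* Lipschitz constant w.r.t. the Riemannian distance of sigma is <= L *)
Definition sigma_lipschitz (sigma : 'rV[R]_n -> 'M[R]_n) (L : R) (f : 'rV[R]_n -> R) :=
  forall gamma : R -> 'rV[R]_n, C1_curve gamma ->
    `|f (gamma 1) - f (gamma 0)| <= L * sigma_length sigma gamma.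

Definition uniformly_spacelike (sigma : 'rV[R]_n -> 'M[R]_n) (f : 'rV[R]_n -> R) :=
  exists eps : R, 0 < eps /\ sigma_lipschitz sigma (1 - eps) f.

Definition lipschitz_fun (f : 'rV[R]_n -> R) :=
  exists L : R, forall x y, `|f x - f y| <= L * enorm (x - y).

(* |w|_sigma^2 = sigma^{ij} w_i w_j, w a covector *)
Definition norm2_sigma (sigma : 'rV[R]_n -> 'M[R]_n) (x : 'rV[R]_n) (w : 'rV[R]_n) : R :=
  \sum_k \sum_l invmx (sigma x) k l * w 0 k * w 0 l.

Definition gup (sigma : 'rV[R]_n -> 'M[R]_n) (x : 'rV[R]_n) (w : 'rV[R]_n) (i j : 'I_n) : R :=
  let si := invmx (sigma x) in
  si i j + (\sum_k \sum_l si i k * si j l * w 0 k * w 0 l) / (1 - norm2_sigma sigma x w).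

Definition christoffel (sigma : 'rV[R]_n -> 'M[R]_n) (x : 'rV[R]_n) (k i j : 'I_n) : R :=
  2^-1 * \sum_l invmx (sigma x) k l *
    (pd (fun y => sigma y j l) i x + pd (fun y => sigma y i l) j x
     - pd (fun y => sigma y i j) l x).

Definition hess_sigma (sigma : 'rV[R]_n -> 'M[R]_n) (f : 'rV[R]_n -> R) (x : 'rV[R]_n) (i j : 'I_n) : R :=
  pd (pd f j) i x - \sum_k christoffel sigma x k i j * pd f k x.

Definition grad (f : 'rV[R]_n -> R) (x : 'rV[R]_n) : 'rV[R]_n := \row_i pd f i x.

Definition open_slab (T : \bar R) : set ('rV[R]_n * R) :=
  [set p | 0 < p.2 /\ (p.2%:E < T)%E].
Definition closed_slab (T : \bar R) : set ('rV[R]_n * R) :=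
  [set p | 0 <= p.2 /\ (p.2%:E < T)%E].

Definition uncurry (u : 'rV[R]_n -> R -> R) : 'rV[R]_n * R -> R :=
  fun p => u p.1 p.2.

Definition C21 (T : \bar R) (u : 'rV[R]_n -> R -> R) : Prop :=
  (forall p, open_slab T p ->
     (forall i, derivable (fun y => u y p.2) p.1 (evec i)) /\
     (forall i j, derivable (pd (fun y => u y p.2) i) p.1 (evec j)) /\
     derivable (fun s => u p.1 s) p.2 1) /\
  (forall p, open_slab T p ->
     {for p, continuous (uncurry u)} /\
     (forall i, {for p, continuous (fun q : 'rV[R]_n * R => pd (fun y => u y q.2) i q.1)}) /\
     (forall i j, {for p, continuous
        (fun q : 'rV[R]_n * R => pd (pd (fun y => u y q.2) i) j q.1)}) /\
     {for p, continuous (fun q : 'rV[R]_n * R => derive1 (fun s => u q.1 s) q.2)}).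

Definition is_solution (sigma : 'rV[R]_n -> 'M[R]_n) (u0 : 'rV[R]_n -> R)
    (T : \bar R) (u : 'rV[R]_n -> R -> R) : Prop :=
  C21 T u /\
  {within closed_slab T, continuous (uncurry u)} /\
  (forall x, u x 0 = u0 x) /\
  (forall x t, 0 < t -> (t%:E < T)%E ->
     derive1 (fun s => u x s) t =
     \sum_i \sum_j gup sigma x (grad (fun y => u y t) x) i j
                   * hess_sigma sigma (fun y => u y t) x i j).

End Defs.

(* Main.v *)
Require Import Defs.
From HB Require Import structures.
From mathcomp Require Import all_boot all_order all_algebra.
From mathcomp Require Import all_classical all_reals all_analysis.
From mathcomp Require Import ring lra.
Import Order.TTheory GRing.Theory Num.Theory.
Import numFieldNormedType.Exports.
Local Open Scope ring_scope.

(** The barrier is [psi = eta / 2 + A |x|^(-1/2) + eps (|x|^2 + k t)].  Where [u - psi] has a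
    positive maximum, [u] and [psi] have the same gradient, so the quasilinear operator can be
    evaluated with the coefficients of [psi]; these are close to the identity for [|x|] large and
    [nabla psi] small, and [|x|^(-1/2)] is strictly superharmonic because [n >= 3].  The quadratic
    term makes the maximum exist: the gradient bound only gives linear growth of [u], a priori.
    It is harmless because [eps |x|^2 <= sup |u0|] at the maximum, so that its gradient is
    [O(sqrt eps)] there.  The preliminary estimate [|u| <= sup |u0|] comes from the same
    comparison with [sup |u0| + eps (|x|^2 + k t)], where [k] may depend on [mu] since [eps]
    tends to 0.  The function [b] is the supremum of [|u x t|] over all solutions and times.
    Since the operator is odd in [u], upper bounds for [c u] with [c = 1, -1] suffice. *)

Set Implicit Arguments. Unset Strict Implicit. Unset Printing Implicit Defensive.
Local Open Scope ring_scope.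
Local Open Scope classical_set_scope.

(** * Directional derivatives and the second derivative test *)

Lemma is_deriveP {R : realType} (V : normedModType R) (f : V -> R) (x v : V) (d : R) :
  is_derive x v f d <-> h^-1 *: (f (h *: v + x) - f x) @[h --> 0^'] --> d.
Proof.
split=> [[df <-] //|fd]; split; first by apply/cvg_ex; exists d.
exact: cvg_lim fd.
Qed.

Lemma is_derive_line {R : realType} (V : normedModType R) (f : V -> R) (x v : V) (s d : R) :
  is_derive (s *: v + x) v f d -> is_derive s 1 (fun t => f (t *: v + x)) d.
Proof.
move=> /is_deriveP fd; apply/is_deriveP.
by under eq_fun do rewrite [_ *: 1]mulr1 scalerDl -addrA.
Qed.

Lemma mean_value {R : realType} (f df : R -> R) (b : R) :
  (forall s : R, is_derive s 1 f (df s)) ->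
  exists2 c, `|c| <= `|b| & f b - f 0 = df c * b.
Proof.
move=> fd.
have fc (A : set R) : {within A, continuous f}.
  apply: continuous_subspaceT => s; apply/differentiable_continuous.
  by apply/derivable1_diffP; case: (fd s).
have [b0|b0] := leP 0 b.
  have [c] := MVT_segment b0 (fun s _ => fd s) (fc _).
  rewrite in_itv /= subr0 => /andP[c0 cb] E; exists c => //.
  by rewrite !ger0_norm.
have [c] := MVT_segment (ltW b0) (fun s _ => fd s) (fc _).
rewrite in_itv /= sub0r mulrN => /andP[bc c0] E; exists c.
  by rewrite !ler0_norm ?lerN2 // ltW.
by rewrite -opprB E opprK.
Qed.

(** [C21] provides partial derivatives only. The increment along [h (v + c e)] splits into one along
    [h v] and one along [h c e]; the mean value theorem turns the latter into [h c] times a nearby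
    value of [g], and [g] is continuous at [x]. *)
Lemma is_derive_dirD {R : realType} (V : normedModType R) (f g : V -> R) (x v e : V) (c d : R) :
  is_derive x v f d -> (forall y, is_derive y e f (g y)) ->
  {for x, continuous g} -> is_derive x (v + c *: e) f (d + c * g x).
Proof.
move=> /is_deriveP fd fe gx; apply/is_deriveP.
have -> : (fun h : R => h^-1 *: (f (h *: (v + c *: e) + x) - f x)) =
  (fun h => h^-1 *: (f (h *: v + x) - f x) +
            h^-1 * (f ((h * c) *: e + (h *: v + x)) - f (h *: v + x))).
  apply/funext => h; rewrite [h *: (v + _)]scalerDr scalerA.
  rewrite -[X in f X - f x]addrA [h *: v + (_ + x)]addrCA.
  by rewrite -[RHS]mulrDr; congr (_ * _); rewrite [RHS]addrC subrKA.
apply: cvgD => //.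
apply/cvgrPdist_le => eps eps0.
have c1 : 0 < 1 + `|c| by rewrite ltr_pwDl.
have /cvgrPdist_lt /(_ _ (divr_gt0 eps0 c1)) := gx.
rewrite near_simpl => /nbhs_normP[del /= del0 Hdel].
(* [|h| N] dominates the displacement [xi e + h v], since [|xi| <= |h c|]; the summand 1 keeps [N]
   positive. *)
pose N := 1 + `|c| * `|e| + `|v|.
have N0 : 0 < N by rewrite /N -addrA ltr_pwDl // addr_ge0 // mulr_ge0.
near=> h.
have h0 : h != 0 by near: h; exact: nbhs_dnbhs_neq.
have hd : `|h| < del / N.
  near: h; apply: dnbhs0_lt; exact: divr_gt0.
have [xi xile E] := @mean_value R _ _ (h * c) (fun s : R =>
  is_derive_line (fe (s *: e + (h *: v + x)))).
move: E; rewrite scale0r add0r => ->.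
set gY := g (xi *: e + _).
have -> : c * g x - h^-1 * (gY * (h * c)) = c * (g x - gY) by field.
rewrite normrM.
have yx : `|x - (xi *: e + (h *: v + x))| < del.
  rewrite addrA [_ + x]addrC opprD addrA subrr sub0r normrN.
  apply: le_lt_trans (ler_normD _ _) _.
  rewrite !normrZ.
  have : `|h| * N < del by rewrite -ltr_pdivlMr.
  apply: le_lt_trans; rewrite /N.
  have : `|xi| * `|e| <= `|h * c| * `|e| by rewrite ler_wpM2r.
  rewrite normrM; have := normr_ge0 h; nra.
have := Hdel _ yx; rewrite /= => /ltW le1.
have : `|c| * `|g x - g (xi *: e + (h *: v + x))| <= `|c| * (eps / (1 + `|c|)).
  by rewrite ler_wpM2l.
move/le_trans; apply.
rewrite mulrCA; apply: ler_piMr; first exact: ltW.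
by rewrite ler_pdivrMr // mul1r ler_wpDl.
Unshelve. all: by end_near.
Qed.

(** The direction [w] is built up one coordinate at a time with [is_derive_dirD]. *)
Lemma is_derive_dir {R : realType} (n : nat) (f : 'rV[R]_n -> R) (g : 'I_n -> 'rV[R]_n -> R)
    (x w : 'rV[R]_n) :
  (forall i y, is_derive y (evec R i) f (g i y)) ->
  (forall i, continuous (g i)) ->
  is_derive x w f (\sum_i w 0 i * g i x).
Proof.
move=> fg gc; rewrite {1}(row_sum_delta w).
elim: (index_enum _) => [|i s IH]; first by rewrite !big_nil; exact: is_derive0.
rewrite !big_cons [X in is_derive _ X]addrC [X in is_derive _ _ _ X]addrC.
by apply: (is_derive_dirD (g := g i)) => //; exact: gc.
Qed.

(** If [dd > 0], then [df] vanishes at 0 and is positive just to the right of it, so the mean value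
    theorem gives [f b > f 0] for some small [b > 0]. *)
Lemma second_derivative_test {R : realType} (f df : R -> R) (dd : R) :
  (\forall s \near (0 : R), is_derive (s : R) 1 f (df s)) -> is_derive (0 : R) 1 df dd ->
  (\forall s \near (0 : R), f s <= f 0) -> df 0 = 0 /\ dd <= 0.
Proof.
move=> fd dfd fmax.
have /nbhs_normP[del /= del0 Hdel] : \forall s \near (0 : R), is_derive (s : R) 1 f (df s) /\ f s <= f 0.
  by near=> s; split; near: s.
have Hd (s : R) : `|s| < del -> is_derive s 1 f (df s) /\ f s <= f 0.
  by move=> sd; apply: Hdel; rewrite /= sub0r normrN.
have D0 : df 0 = 0.
  have ab : - del <= del by rewrite ge0_cp // ltW.
  have H (t : R) : t \in `](- del), del[%R -> `|t| < del by rewrite in_itv /= ltr_norml.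
  have c0 : (0 : R) \in `](- del), del[%R by rewrite in_itv /= oppr_lt0 del0.
have [_ dv0] := @derive1_at_max R f (- del) del 0 ab
   (fun t ht => let: conj (DeriveDef a _) _ := Hd t (H t ht) in a) c0
   (fun t ht => proj2 (Hd t (H t ht))).
have [|[_ <-] _] := Hd 0; first by rewrite normr0.
  exact: dv0.
split=> //; rewrite leNgt; apply/negP => dd0.
have /is_deriveP /cvgrPdist_lt /(_ _ dd0) := dfd.
rewrite near_withinE => /nbhs_normP[e /= e0 He].
pose b := Num.min e del / 2.
have m0 : 0 < Num.min e del by rewrite lt_min e0.
have b0 : 0 < b by rewrite divr_gt0.
have /andP[be bd] : (b < e) && (b < del) by rewrite -lt_min /b; lra.
have dfpos s : 0 < s -> s <= b -> 0 < df s.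
  move=> s0 sb.
  have := He s; rewrite /= sub0r normrN gtr0_norm // => /(_ (le_lt_trans sb be)).
  rewrite addr0 D0 subr0 (gt_eqF s0) => /(_ isT).
  rewrite ltr_distlC => /andP[+ _]; rewrite subrr => /(mulr_gt0 s0).
  have -> : s^-1 *: df s%:A = s^-1 * df s by rewrite [s%:A]mulr1.
  by rewrite mulrA divff ?gt_eqF // mul1r.
have fdb (s : R) : s \in `]0, b[%R -> is_derive s 1 f (df s).
  rewrite in_itv /= => /andP[s0 sb]; apply: (proj1 (Hd s _)).
  by rewrite gtr0_norm // (lt_trans sb).
have fc : {within `[0, b], continuous f}.
  apply: derivable_within_continuous => s; rewrite in_itv /= => /andP[s0 sb].
  have [|[]//] := Hd s; by rewrite ger0_norm // (le_lt_trans sb).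
have [c] := MVT b0 fdb fc.
rewrite in_itv /= subr0 => /andP[c0 cb] E.
have := Hd b; rewrite gtr0_norm // => /(_ bd)[_].
rewrite -subr_le0 E leNgt mulr_gt0 //; exact: dfpos (ltW cb).
Unshelve. all: by end_near.
Qed.

(** * Positive definite matrices *)

Lemma mx_quadE {R : realType} (n : nat) (A : 'M[R]_n) (v w : 'rV[R]_n) :
  (v *m A *m w^T) 0 0 = \sum_i \sum_j A i j * v 0 i * w 0 j.
Proof.
rewrite mxE exchange_big; apply: eq_bigr => j _ /=.
rewrite !mxE mulr_suml; apply: eq_bigr => i _; ring.
Qed.

Definition posdef {R : realType} (n : nat) (A : 'M[R]_n) :=
  A^T = A /\ forall v : 'rV[R]_n, v != 0 -> 0 < (v *m A *m v^T) 0 0.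

Lemma posdef_ge0 {R : realType} (n : nat) (A : 'M[R]_n) (v : 'rV[R]_n) :
  posdef A -> 0 <= (v *m A *m v^T) 0 0.
Proof.
case=> _ pA; have [->|/pA/ltW//] := eqVneq v 0.
by rewrite !mul0mx mxE.
Qed.

(** Induction on the dimension: the Schur complement of the top left entry is again positive
    definite, and its factor [C] is completed by the first row of [A] divided by the square root of
    that entry. *)
Lemma cholesky {R : realType} (n : nat) (A : 'M[R]_n) :
  posdef A -> exists B : 'M[R]_n, A = B^T *m B.
Proof.
elim: n A => [|n IH] A [symA pA]; first by exists 0; rewrite [LHS]flatmx0 [RHS]flatmx0.
change (n.+1) with (1 + n)%N in A, symA, pA |- *.
pose a := ulsubmx A 0 0; pose b := ursubmx A; pose D := drsubmx A.
have DA : A = block_mx a%:M b b^T D.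
  rewrite -{1}[A]submxK -mx11_scalar; congr block_mx.
  by rewrite /b trmx_ursub symA.
have a0 : 0 < a.
  have := pA (row_mx 1%:M 0).
  rewrite DA mul_row_block !mul1mx !mul0mx !addr0 tr_row_mx mul_row_col trmx0 mulmx0 addr0.
  rewrite trmx1 mulmx1 mxE eqxx mulr1n; apply.
  apply/eqP => /matrixP /(_ 0 0); rewrite mxE; case: splitP => // j.
  by rewrite !mxE ord1 eqxx => _ /eqP; rewrite oner_eq0.
have symD : D^T = D by rewrite /D trmx_drsub symA.
have [|C EC] := IH (D - a^-1 *: (b^T *m b)).
  split; first by rewrite linearB linearZ /= trmx_mul trmxK symD.
  move=> v v0.
  (* The form of the Schur complement at [v] is the form of [A] at [v] extended by the first
     coordinate that minimizes it. *)
  have := pA (row_mx (- a^-1 *: (v *m b^T)) v).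
  have -> : (row_mx (- a^-1 *: (v *m b^T)) v *m A *m (row_mx (- a^-1 *: (v *m b^T)) v)^T) =
    (v *m (D - a^-1 *: (b^T *m b)) *m v^T).
    rewrite DA mul_row_block tr_row_mx mul_row_col.
    rewrite -!scalemxAl mul_mx_scalar scalerA mulNr mulVf ?gt_eqF // scaleN1r addNr mul0mx add0r.
    by rewrite mulmxBr scaleNr -scalemxAr mulmxA addrC.
  apply; apply: contra_neq v0 => vH; apply/rowP => i.
  have := congr1 (fun M : 'rV[R]_(1 + n) => M 0 (rshift 1 i)) vH.
  by rewrite row_mxEr => ->; rewrite !mxE.
have s0 : Num.sqrt a != 0 by rewrite sqrtr_eq0 -ltNge.
have ss : Num.sqrt a * Num.sqrt a = a by rewrite -expr2 sqr_sqrtr // ltW.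
exists (block_mx (Num.sqrt a)%:M ((Num.sqrt a)^-1 *: b) 0 C : 'M[R]_(1 + n)).
rewrite tr_block_mx mulmx_block DA !tr_scalar_mx !trmx0 !mul0mx !mulmx0 !addr0.
congr block_mx.
- by rewrite -scalar_mxM ss.
- by rewrite mul_scalar_mx scalerA divff // scale1r.
- by rewrite [(_ *: b)^T]linearZ mul_mx_scalar scalerA divff // scale1r.
- by rewrite -EC [(_ *: b)^T]linearZ -scalemxAl -scalemxAr scalerA -invfM ss addrC subrK.
Qed.

Lemma posdef_unitmx {R : realType} (n : nat) (A : 'M[R]_n) : posdef A -> A \in unitmx.
Proof.
case=> _ pA; rewrite -row_free_unit -kermx_eq0; apply/rowV0P => v /sub_kermxP vA.
by apply/eqP; apply: contraT => /pA; rewrite vA mul0mx mxE ltxx.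
Qed.

Lemma posdef_invmx {R : realType} (n : nat) (A : 'M[R]_n) : posdef A -> posdef (invmx A).
Proof.
move=> pA; have uA := posdef_unitmx pA; case: pA => symA pA.
have symI : (invmx A)^T = invmx A by rewrite trmx_inv symA.
split=> // v v0; have := pA (v *m invmx A).
rewrite trmx_mul symI !mulmxA mulmxKV //; apply.
by apply: contraNneq v0 => vA; rewrite -(mulmxKV uA v) vA mul0mx.
Qed.

(** With [A = B^T B] the sum becomes the quadratic form of [H] summed over the rows of [B]. *)
Lemma posdef_trace_le0 {R : realType} (n : nat) (A H : 'M[R]_n) : posdef A ->
  (forall w : 'rV[R]_n, \sum_i \sum_j w 0 i * w 0 j * H i j <= 0) ->
  \sum_i \sum_j A i j * H i j <= 0.
Proof.
move=> /cholesky[B ->] Hle.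
have -> : \sum_i \sum_j (B^T *m B) i j * H i j =
    \sum_k \sum_i \sum_j row k B 0 i * row k B 0 j * H i j.
  rewrite [RHS]exchange_big; apply: eq_bigr => i _; rewrite /= exchange_big /=.
  apply: eq_bigr => j _; rewrite mxE mulr_suml; apply: eq_bigr => k _.
  by rewrite !mxE.
by apply: sumr_le0 => k _; exact: Hle.
Qed.

(** The form is nonnegative at [v + w] and at [v - w]. This version of Cauchy-Schwarz avoids square
    roots. *)
Lemma posdef_young {R : realType} (n : nat) (A : 'M[R]_n) (v w : 'rV[R]_n) : posdef A ->
  2 * `|(v *m A *m w^T) 0 0| <= (v *m A *m v^T) 0 0 + (w *m A *m w^T) 0 0.
Proof.
move=> pA.
have E1 := posdef_ge0 (v + w) pA; have E2 := posdef_ge0 (v - w) pA.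
have S : (w *m A *m v^T) 0 0 = (v *m A *m w^T) 0 0.
  by rewrite -[in LHS](trmxK w) -[in LHS]pA.1 -trmx_mul -[in LHS](trmxK v^T) -trmx_mul trmxK mxE mulmxA.
move: E1 E2.
rewrite [(v - w)^T]linearB [(v + w)^T]linearD /=.
rewrite !(mulmxBl, mulmxDl) !(mulmxBr, mulmxDr).
have aE (P Q : 'M[R]_1) : (P + Q) 0 0 = P 0 0 + Q 0 0 by rewrite mxE.
have oE (P : 'M[R]_1) : (- P) 0 0 = - P 0 0 by rewrite mxE.
rewrite !(aE, oE) S => E1 E2.
rewrite -[X in X * `|_|]ger0_norm // -normrM ler_norml; apply/andP; split; lra.
Qed.

(** * Convergence at infinity and compactness *)

(** Radial functions are written [F (sqn x)]: along a line [sqn] is a quadratic polynomial, so no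
    square root has to be differentiated. *)
Definition sqn {R : realType} (n : nat) (x : 'rV[R]_n) : R := \sum_i x 0 i ^+ 2.

Lemma sqn_ge0 {R : realType} (n : nat) (x : 'rV[R]_n) : 0 <= sqn x.
Proof. by apply: sumr_ge0 => i _; exact: sqr_ge0. Qed.

Lemma enorm_ge0 {R : realType} (n : nat) (x : 'rV[R]_n) : 0 <= enorm x.
Proof. exact: sqrtr_ge0. Qed.

Lemma enorm2 {R : realType} (n : nat) (x : 'rV[R]_n) : enorm x ^+ 2 = sqn x.
Proof. exact: sqr_sqrtr (sqn_ge0 x). Qed.

Lemma coord_le_enorm {R : realType} (n : nat) (x : 'rV[R]_n) i : `|x 0 i| <= enorm x.
Proof.
rewrite -(ler_pXn2r (n := 2)) ?nnegrE ?enorm_ge0 // real_normK ?num_real // enorm2.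
by rewrite /sqn (bigD1 i) //= lerDl sumr_ge0 // => j _; exact: sqr_ge0.
Qed.

Lemma le_enorm {R : realType} (n : nat) (x : 'rV[R]_n) (r : R) : 0 <= r ->
  (r <= enorm x) = (r ^+ 2 <= sqn x).
Proof. by move=> r0; rewrite -enorm2 ler_pXn2r ?nnegrE ?enorm_ge0. Qed.

Lemma enorm_le {R : realType} (n : nat) (x : 'rV[R]_n) (r : R) : 0 <= r ->
  (enorm x <= r) = (sqn x <= r ^+ 2).
Proof. by move=> r0; rewrite -enorm2 ler_pXn2r ?nnegrE ?enorm_ge0. Qed.

Lemma cvg_fsum {R : realType} (T : Type) (F : set_system T) (I : Type) (r : seq I) (P : pred I)
    (f : I -> T -> R) (l : I -> R) {FF : Filter F} :
  (forall i, P i -> f i x @[x --> F] --> l i) ->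
  \sum_(i <- r | P i) f i x @[x --> F] --> \sum_(i <- r | P i) l i.
Proof. by move=> ?; apply: cvg_big => //; exact: add_continuous. Qed.

Lemma cvg_fprod {R : realType} (T : Type) (F : set_system T) (I : Type) (r : seq I) (P : pred I)
    (f : I -> T -> R) (l : I -> R) {FF : Filter F} :
  (forall i, P i -> f i x @[x --> F] --> l i) ->
  \prod_(i <- r | P i) f i x @[x --> F] --> \prod_(i <- r | P i) l i.
Proof. by move=> ?; apply: cvg_big => //; exact: mul_continuous. Qed.

Lemma sqn_continuous {R : realType} (n : nat) : continuous (@sqn R n).
Proof.
apply: (@continuous_big _ _ (@GRing.add R) 0 xpredT add_continuous) => i _ x.
have c : {for x, continuous (fun y : 'rV[R]_n => y 0 i)} by exact: coord_continuous.
exact: (continuousM c c).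
Qed.

Lemma cvg_det {R : realType} (T : Type) (F : set_system T) (n : nat)
    (A : T -> 'M[R]_n) (L : 'M[R]_n) {FF : Filter F} :
  (forall i j, A x i j @[x --> F] --> L i j) -> \det (A x) @[x --> F] --> \det L.
Proof.
move=> AL; apply: cvg_fsum => s _; apply: cvgM; first exact: cvg_cst.
by apply: cvg_fprod => i _; exact: AL.
Qed.

(** By Cramer's rule the entries are quotients of determinants. The filter is arbitrary, so that
    both continuity at a point and the limit at infinity follow. *)
Lemma cvg_invmx {R : realType} (T : Type) (F : set_system T) (n : nat)
    (A : T -> 'M[R]_n) (L : 'M[R]_n) {FF : Filter F} :
  (forall x, A x \in unitmx) -> L \in unitmx ->
  (forall i j, A x i j @[x --> F] --> L i j) ->
  forall i j, invmx (A x) i j @[x --> F] --> invmx L i j.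
Proof.
move=> uA uL AL i j.
rewrite /invmx uL mxE; under eq_fun do rewrite uA mxE.
apply: cvgM.
  by apply: cvgV; [rewrite -unitfE -unitmxE|exact: cvg_det].
rewrite mxE; under eq_fun do rewrite mxE.
apply: cvgM; first exact: cvg_cst.
apply: cvg_det => k l; rewrite !mxE; under eq_fun do rewrite !mxE.
exact: AL.
Qed.

(** Turns limits for [|x|] tending to infinity into filter limits, to which the convergence lemmas
    above apply. *)
Definition at_infinity {R : realType} (n : nat) : set_system 'rV[R]_n :=
  [set A | exists r : R, forall x, r <= enorm x -> A x].

#[local] Instance at_infinity_filter {R : realType} (n : nat) : Filter (@at_infinity R n).
Proof.
split; first by exists 0.
- move=> P Q [p Pp] [q Qq]; exists (Num.max p q) => x.
  by rewrite ge_max => /andP[/Pp Px /Qq Qx]; split.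
- by move=> P Q PQ [p Pp]; exists p => x /Pp /PQ.
Qed.

Lemma enorm_cvg_infinity {R : realType} (n : nat) :
  (@enorm R n x) @[x --> @at_infinity R n] --> +oo.
Proof.
move=> A [r [_ rA]]; exists (r + 1) => x rx; apply: rA.
by apply: lt_le_trans rx; rewrite ltrDl.
Qed.

Lemma coord2_le_sqn {R : realType} (n : nat) (x : 'rV[R]_n) i : x 0 i ^+ 2 <= sqn x.
Proof. by rewrite /sqn (bigD1 i) //= lerDl sumr_ge0 // => j _; exact: sqr_ge0. Qed.

Lemma annulus_compact {R : realType} (n : nat) (a b : R) :
  compact [set x : 'rV[R]_n | a <= sqn x <= b].
Proof.
(* [t^2 <= b] implies [|t| <= 1 + b], so this box contains the annulus. *)
pose B := [set v : 'rV[R]_n | forall i, `[- (1 + b), 1 + b] (v ord0 i)].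
have cB : compact B by apply: (@rV_compact R n (fun=> `[- (1 + b), 1 + b])) => i; exact: segment_compact.
apply: (subclosed_compact _ cB).
  have -> : [set x : 'rV[R]_n | a <= sqn x <= b] = @sqn R n @^-1` `[a, b].
    by apply/seteqP; split=> x; rewrite /= in_itv.
  apply: preimage_closed => [x _|]; first exact: sqn_continuous.
  exact: itv_closed.
move=> x /= /andP[_ xb] i.
rewrite /= in_itv /= -ler_norml.
have := le_trans (coord2_le_sqn x i) xb.
rewrite -real_normK ?num_real //; have := normr_ge0 (x ord0 i); nra.
Qed.

Lemma bounded_fun_at_infinity {R : realType} (n : nat) (f : 'rV[R]_n -> R) :
  continuous f -> (exists B : R, \forall x \near @at_infinity R n, `|f x| <= B) ->
  exists B : R, forall x, `|f x| <= B.
Proof.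
move=> fc [B [r rB]].
(* Since [sqn] is nonnegative, the lower bound -1 makes this annulus a closed ball. *)
pose K := [set x : 'rV[R]_n | -1 <= sqn x <= r ^+ 2].
have [K0|K0] := pselect (K !=set0).
  have [|c _ cmax] := @compact_EVT_max _ R (fun x => `|f x|) K K0 (@annulus_compact R n _ _).
    by apply: continuous_subspaceT => x; exact: (continuous_comp (fc x) (@norm_continuous _ _ (f x))).
  exists (Num.max B `|f c|) => x; rewrite le_max.
  have [/rB ->//|xr] := leP r (enorm x).
  apply/orP; right; apply: cmax; rewrite inE /K /=.
  rewrite (le_trans _ (sqn_ge0 x)) ?lerN10 //= -enorm_le ?ltW //.
  exact: le_lt_trans (enorm_ge0 x) xr.
exists B => x; apply: rB; rewrite leNgt; apply/negP => xr; apply: K0; exists x.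
rewrite /K /= (le_trans _ (sqn_ge0 x)) ?lerN10 //= -enorm_le ?ltW //.
exact: le_lt_trans (enorm_ge0 x) xr.
Qed.

Lemma uniform_bound {R : realType} (I : finType) (T : Type) (f : I -> T -> R) :
  (forall i, exists B : R, forall x, `|f i x| <= B) ->
  exists2 B : R, 0 <= B & forall i x, `|f i x| <= B.
Proof.
move=> /choice[B fB]; exists (\sum_i `|B i|) => [|i x]; first exact: sumr_ge0.
apply: (le_trans (fB i x)); rewrite (bigD1 i) //=.
by rewrite (le_trans (ler_norm _)) // lerDl sumr_ge0.
Qed.

(** Outside a large ball the values are below 1; inside it the Lipschitz bound controls the distance
    to [f 0]. *)
Lemma vanishing_bounded {R : realType} (n : nat) (f : 'rV[R]_n -> R) :
  lipschitz_fun f -> vanishes_at_infinity f ->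
  exists2 B : R, 0 <= B & forall x, `|f x| <= B.
Proof.
move=> [L fL] fv; have [r rf] := fv _ ltr01.
exists (1 + `|f 0| + `|L| * `|r|); first by rewrite !addr_ge0 // mulr_ge0.
move=> x; have [/rf/ltW fx|xr] := leP r (enorm x).
  by rewrite (le_trans fx) // -addrA lerDl addr_ge0 // mulr_ge0.
have := fL x 0; rewrite subr0 => fx.
have : L * enorm x <= `|L| * `|r|.
  apply: (@le_trans _ _ (`|L| * enorm x)); first by rewrite ler_wpM2r ?enorm_ge0 ?ler_norm.
  by rewrite ler_wpM2l // (le_trans (ltW xr)) ?ler_norm.
have := ler_normD (f x - f 0) (f 0); rewrite subrK; lra.
Qed.

(** * Bounds for an asymptotically flat metric *)

Lemma metric_posdef {R : realType} (n : nat) (sigma : 'rV[R]_n -> 'M[R]_n) x :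
  riemannian_metric sigma -> posdef (sigma x).
Proof.
by case=> _ [sym pos]; split; [apply/matrixP => i j; rewrite mxE sym|exact: pos].
Qed.

Lemma smooth_continuous {R : realType} (n : nat) (f : 'rV[R]_n -> R) :
  smooth f -> continuous f.
Proof. by move=> /(_ [::])[]. Qed.

Lemma smooth_pd_continuous {R : realType} (n : nat) (f : 'rV[R]_n -> R) i :
  smooth f -> continuous (pd f i).
Proof. by move=> /(_ [:: i])[]. Qed.

(** The derivatives are weighted by [|x|] because Christoffel symbols enter the operator on radial
    functions only contracted with [x]. *)
Lemma asymptotics {R : realType} (n : nat) (sigma : 'rV[R]_n -> 'M[R]_n) i j :
  asymptotically_flat sigma ->
  (sigma x i j @[x --> @at_infinity R n] --> (1%:M : 'M[R]_n) i j) /\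
  forall k, (pd (fun y => sigma y i j) k x * enorm x @[x --> @at_infinity R n] --> (0 : R)).
Proof.
move=> [_ [omega [_ [omega0 [C [r sflat]]]]]].
have omegaC : C * omega (enorm x) @[x --> @at_infinity R n] --> (0 : R).
  rewrite -(mulr0 C); apply: cvgM; first exact: cvg_cst.
  exact: cvg_comp (@enorm_cvg_infinity R n) omega0.
have small e : 0 < e -> exists M, forall x : 'rV[R]_n, M <= enorm x ->
    [/\ r <= enorm x, 1 <= enorm x & C * omega (enorm x) <= e].
  move=> e0; have /cvgrPdist_le /(_ _ e0)[M HM] := omegaC.
  (* The 1 in the maximum keeps [enorm x] positive, so that the division by it can be cleared. *)
  exists (Num.max r (Num.max 1 M)) => x; rewrite !ge_max => /and3P[rx x1 xM].
  split=> //; apply: le_trans (ler_norm _) _.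
  by have := HM x xM; rewrite /= sub0r normrN.
split=> [|k]; apply/cvgrPdist_le => e /small[M HM]; exists M => x /HM[rx x1 xe].
  by have [+ _] := sflat x rx i j; rewrite distrC mxE => /le_trans; apply.
have [_ /(_ k)] := sflat x rx i j.
rewrite ler_pdivlMr ?(lt_le_trans ltr01) // => /le_trans /(_ xe).
by rewrite sub0r normrN normrM (ger0_norm (enorm_ge0 x)).
Qed.

Lemma cvg_inverse_metric {R : realType} (n : nat) (sigma : 'rV[R]_n -> 'M[R]_n) i j :
  asymptotically_flat sigma ->
  invmx (sigma x) i j @[x --> @at_infinity R n] --> (1%:M : 'M[R]_n) i j.
Proof.
move=> sflat; rewrite -invmx1; apply: cvg_invmx => [x||k l].
- exact: posdef_unitmx (metric_posdef x sflat.1).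
- exact: unitmx1.
- by have [] := asymptotics k l sflat.
Qed.

Lemma cvg_bounded {R : realType} (n : nat) (f : 'rV[R]_n -> R) (l : R) :
  continuous f -> f x @[x --> @at_infinity R n] --> l ->
  exists B : R, forall x, `|f x| <= B.
Proof.
move=> fc fl; apply: bounded_fun_at_infinity => //.
have /cvgrPdist_le /(_ _ ltr01)[r fr] := fl.
exists (1 + `|l|); exists r => x /fr /= lf.
by have := ler_normB l (l - f x); rewrite opprB addrC subrK; lra.
Qed.

(** Each quantity is continuous and controlled near infinity by [asymptotics], hence bounded; there
    are finitely many of them. *)
Lemma metric_bounds {R : realType} (n : nat) (sigma : 'rV[R]_n -> 'M[R]_n) :
  asymptotically_flat sigma ->
  exists2 m : R, 0 <= m & forall x i j, [/\ `|sigma x i j| <= m, `|invmx (sigma x) i j| <= m &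
    forall k l, `|pd (fun y => sigma y i j) k x * x 0 l| <= m].
Proof.
move=> sflat; have [sm _] := sflat.1.
have [|m1 m10 H1] := @uniform_bound R ('I_n * 'I_n)%type _ (fun ij x => sigma x ij.1 ij.2).
  move=> [i j] /=; apply: (cvg_bounded _ (asymptotics i j sflat).1).
  exact: smooth_continuous (sm i j).
have [|m2 m20 H2] := @uniform_bound R ('I_n * 'I_n)%type _ (fun ij x => invmx (sigma x) ij.1 ij.2).
  move=> [i j] /=; apply: (cvg_bounded _ (@cvg_inverse_metric _ _ _ i j sflat)) => x.
  apply: (@cvg_invmx R _ (nbhs x) n sigma _ (nbhs_filter x)) => [y||k l].
  - exact: posdef_unitmx (metric_posdef y sflat.1).
  - exact: posdef_unitmx (metric_posdef x sflat.1).
  - exact: smooth_continuous (sm k l) x.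
have [|m3 m30 H3] := @uniform_bound R ('I_n * 'I_n * ('I_n * 'I_n))%type _
    (fun ijkl x => pd (fun y => sigma y ijkl.1.1 ijkl.1.2) ijkl.2.1 x * x 0 ijkl.2.2).
  move=> [[i j] [k l]] /=; apply: bounded_fun_at_infinity => [x|].
    apply: continuousM; first exact: smooth_pd_continuous (sm i j) x.
    exact: coord_continuous.
  have /cvgrPdist_le /(_ _ ltr01)[r fr] := (asymptotics i j sflat).2 k.
  exists 1; exists r => x /fr /=; rewrite sub0r normrN !normrM (ger0_norm (enorm_ge0 x)).
  by apply: le_trans; rewrite ler_wpM2l // coord_le_enorm.
exists (m1 + m2 + m3); first by rewrite !addr_ge0.
move=> x i j; split=> [||k l].
- by have := H1 (i, j) x; rewrite /=; lra.
- by have := H2 (i, j) x; rewrite /=; lra.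
- by have := H3 ((i, j), (k, l)) x; rewrite /=; lra.
Qed.

Lemma metric_small {R : realType} (n : nat) (sigma : 'rV[R]_n -> 'M[R]_n) (e : R) :
  asymptotically_flat sigma -> 0 < e ->
  exists r : R, forall x, r <= enorm x -> forall i j,
    `|invmx (sigma x) i j - (i == j)%:R| <= e /\ forall k, `|pd (fun y => sigma y i j) k x| * enorm x <= e.
Proof.
move=> sflat e0.
have /choice[r1 H1] : forall ij : 'I_n * 'I_n, exists r : R, forall x : 'rV[R]_n,
    r <= enorm x -> `|invmx (sigma x) ij.1 ij.2 - (ij.1 == ij.2)%:R| <= e.
  move=> [i j]; have /cvgrPdist_le /(_ _ e0)[r fr] := @cvg_inverse_metric _ _ _ i j sflat.
  by exists r => x /fr; rewrite /= mxE distrC.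
have /choice[r2 H2] : forall ijk : 'I_n * 'I_n * 'I_n, exists r : R, forall x : 'rV[R]_n,
    r <= enorm x -> `|pd (fun y => sigma y ijk.1.1 ijk.1.2) ijk.2 x| * enorm x <= e.
  move=> [[i j] k]; have /cvgrPdist_le /(_ _ e0)[r fr] := (asymptotics i j sflat).2 k.
  by exists r => x /fr; rewrite /= sub0r normrN normrM (ger0_norm (enorm_ge0 x)).
(* The sum of the absolute values is a common upper bound for the finitely many radii. *)
exists (\sum_ij `|r1 ij| + \sum_ijk `|r2 ijk|) => x xr i j.
have le1 ij : r1 ij <= \sum_ij `|r1 ij|.
  by rewrite (bigD1 ij) //= (le_trans (ler_norm _)) // lerDl sumr_ge0.
have le2 ijk : r2 ijk <= \sum_ijk `|r2 ijk|.
  by rewrite (bigD1 ijk) //= (le_trans (ler_norm _)) // lerDl sumr_ge0.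
split=> [|k].
  apply: (H1 (i, j)); apply: le_trans (le1 _) (le_trans _ xr).
  by rewrite lerDl sumr_ge0.
apply: (H2 ((i, j), k)); apply: le_trans (le2 _) (le_trans _ xr).
by rewrite lerDr sumr_ge0.
Qed.

(** * Raised covectors and the coefficients of the operator *)

Definition raise {R : realType} (n : nat) (sigma : 'rV[R]_n -> 'M[R]_n) (x p : 'rV[R]_n) i : R :=
  \sum_k invmx (sigma x) i k * p 0 k.

(** The double sum factors, so [g^{ij}] is the inverse metric plus a rank one term. *)
Lemma gupE {R : realType} (n : nat) (sigma : 'rV[R]_n -> 'M[R]_n) (x p : 'rV[R]_n) i j :
  gup sigma x p i j = invmx (sigma x) i j +
    raise sigma x p i * raise sigma x p j / (1 - norm2_sigma sigma x p).
Proof.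
rewrite /gup; congr (_ + _ / _); rewrite /raise mulr_suml; apply: eq_bigr => k _.
by rewrite mulr_sumr; apply: eq_bigr => l _; ring.
Qed.

Lemma norm2E {R : realType} (n : nat) (sigma : 'rV[R]_n -> 'M[R]_n) (x p : 'rV[R]_n) :
  norm2_sigma sigma x p = (p *m invmx (sigma x) *m p^T) 0 0.
Proof. by rewrite mx_quadE. Qed.

(** This is [posdef_young] for the inverse metric, with the [i]-th basis vector and [p]. *)
Lemma raise_le {R : realType} (n : nat) (sigma : 'rV[R]_n -> 'M[R]_n) (x p : 'rV[R]_n) i :
  riemannian_metric sigma ->
  2 * `|raise sigma x p i| <= invmx (sigma x) i i + norm2_sigma sigma x p.
Proof.
move=> rm; have := posdef_young (evec R i) p (posdef_invmx (metric_posdef x rm)).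
rewrite norm2E.
have -> : evec R i *m invmx (sigma x) = row i (invmx (sigma x)) by rewrite rowE.
have -> : (row i (invmx (sigma x)) *m p^T) 0 0 = raise sigma x p i.
  by rewrite mxE; apply: eq_bigr => k _; rewrite !mxE.
by rewrite -[X in _ <= X + _ -> _]/((row i (invmx (sigma x)) *m (delta_mx 0 i)^T) 0 0) trmx_delta -colE !mxE.
Qed.

(** Here [posdef_young] is used with the [i]-th row of [sigma x]: the inverse metric sends it to the
    basis vector, so the mixed term is [p 0 i]. *)
Lemma covector_le {R : realType} (n : nat) (sigma : 'rV[R]_n -> 'M[R]_n) (x p : 'rV[R]_n) i :
  riemannian_metric sigma ->
  2 * `|p 0 i| <= sigma x i i + norm2_sigma sigma x p.
Proof.
move=> rm; have ps := metric_posdef x rm; have us := posdef_unitmx ps.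
have := posdef_young (row i (sigma x)) p (posdef_invmx ps).
rewrite norm2E {1 2}rowE mulmxK // -[X in _ <= X + _ -> _]/((delta_mx 0 i *m (row i (sigma x))^T) 0 0).
by rewrite -!rowE !mxE.
Qed.

Lemma norm_sum_le {R : realType} (n : nat) (f : 'I_n -> R) (c : R) :
  (forall i, `|f i| <= c) -> `|\sum_i f i| <= n%:R * c.
Proof.
move=> fc; apply: le_trans (ler_norm_sum _ _ _) _.
by apply: le_trans (ler_sum _ (fun i _ => fc i)) _; rewrite sumr_const card_ord mulr_natl.
Qed.

(** * The operator on radial functions *)

(* On a radial function [F (sqn x)] with gradient [p], the operator [g^{ij}(p) nabla^2_{ij}]
   equals [2 F' drift + 4 F'' quad]. *)
Definition drift {R : realType} (n : nat) (sigma : 'rV[R]_n -> 'M[R]_n) (x p : 'rV[R]_n) : R :=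
  \sum_i \sum_j gup sigma x p i j * ((i == j)%:R - \sum_k christoffel sigma x k i j * x 0 k).

Definition quad {R : realType} (n : nat) (sigma : 'rV[R]_n -> 'M[R]_n) (x p : 'rV[R]_n) : R :=
  \sum_i \sum_j gup sigma x p i j * (x 0 i * x 0 j).

Lemma christoffel_le {R : realType} (n : nat) (sigma : 'rV[R]_n -> 'M[R]_n) (x : 'rV[R]_n)
    (a b : R) (i j : 'I_n) :
  (forall i j, `|invmx (sigma x) i j| <= a) ->
  (forall i j k l, `|pd (fun y => sigma y i j) k x * x 0 l| <= b) ->
  `|\sum_k christoffel sigma x k i j * x 0 k| <= 2 * n%:R ^+ 2 * (a * b).
Proof.
move=> sa pb.
have a0 : 0 <= a by exact: le_trans (sa i j).
have b0 : 0 <= b by exact: le_trans (pb i j i j).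
(* The sums over [k] and [l] give [n^2]. The bracket has three derivatives, each at most [b] once
   multiplied by the coordinate, and is estimated by [4 b]. *)
have -> : 2 * n%:R ^+ 2 * (a * b) = n%:R * (2^-1 * (n%:R * (a * (4 * b)))) by field.
apply: norm_sum_le => k; rewrite /christoffel -mulrA normrM ger0_norm ?invr_ge0 //.
rewrite ler_pM2l ?invr_gt0 // mulr_suml; apply: norm_sum_le => l.
rewrite -mulrA normrM; apply: ler_pM => //.
rewrite mulrBl mulrDl; apply: le_trans (ler_normB _ _) _.
apply: le_trans (lerD (ler_normD _ _) (lexx _)) _.
have := pb j l i k; have := pb i l j k; have := pb i j l k; lra.
Qed.

(** The estimate covers all [x], at the price of a constant depending on [mu], which bounds the
    denominator in [g^{ij}] from below. *)
Lemma drift_bound {R : realType} (n : nat) (sigma : 'rV[R]_n -> 'M[R]_n) (mu : R) :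
  asymptotically_flat sigma -> 0 < mu ->
  exists2 K : R, 0 <= K & forall x p, norm2_sigma sigma x p <= 1 - mu -> drift sigma x p <= K.
Proof.
move=> sflat mu0; have [m m0 Hm] := metric_bounds sflat.
(* [G] bounds [|g^{ij}|]: the raised components are at most [m + 1] and the denominator is at least
   [mu]. *)
pose G := m + (m + 1) * (m + 1) / mu.
have G0 : 0 <= G by rewrite addr_ge0 // divr_ge0 ?(ltW mu0) // mulr_ge0 // addr_ge0.
pose c := 2 * n%:R ^+ 2 * (m * m) : R.
have c0 : 0 <= c by rewrite !mulr_ge0 // exprn_ge0.
exists (n%:R * (n%:R * (G * (1 + c)))); first by rewrite !mulr_ge0 // addr_ge0.
move=> x p px; apply: le_trans (ler_norm _) _.
apply: norm_sum_le => i; apply: norm_sum_le => j.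
rewrite normrM; apply: ler_pM => //.
  have praise k : `|raise sigma x p k| <= m + 1.
    have := raise_le x p k sflat.1; have [_ + _] := Hm x k k.
    have := ler_norm (invmx (sigma x) k k); have := normr_ge0 (raise sigma x p k); lra.
  rewrite gupE; apply: le_trans (ler_normD _ _) _; apply: lerD; first by have [] := Hm x i j.
  rewrite normrM normfV normrM; apply: ler_pM => //.
 - exact: ler_pM.
  rewrite lef_pV2 ?posrE ?normr_gt0; last 2 first.
  - by rewrite gt_eqF //; lra.
  - by [].
  by apply: le_trans (ler_norm _); lra.
apply: le_trans (ler_normB _ _) _; apply: lerD; first by case: (i == j); rewrite ?normr0 ?normr1.
apply: christoffel_le => [k l|k l r s]; have [_ + H] := Hm x k l => // _; exact: H.
Qed.

(** For [|x|] large and [p] small, [g^{ij}] is close to the identity and the contracted Christoffel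
    symbols are small, so [drift] and [quad] are close to their Euclidean values. *)
Lemma drift_quad_asymptotics {R : realType} (n : nat) (sigma : 'rV[R]_n -> 'M[R]_n) :
  (0 < n)%N -> asymptotically_flat sigma ->
  exists d : R, 0 < d /\ exists r : R, forall x p : 'rV[R]_n, r <= enorm x -> (forall k, `|p 0 k| <= d) ->
    `|drift sigma x p - n%:R| <= 8^-1 /\ `|quad sigma x p - sqn x| <= 8^-1 * sqn x.
Proof.
move=> n0 sflat.
have N1 : 1 <= n%:R :> R by rewrite ler1n.
have N0 : 0 < n%:R :> R by rewrite ltr0n.
pose N : R := n%:R; rewrite -/N in N1 N0 *.
(* The error of [drift] will be at most [7 N^4 e], which is [1/8] for this [e]. *)
pose e : R := 56^-1 / N ^+ 4.
have e0 : 0 < e by rewrite divr_gt0 ?invr_gt0 ?exprn_gt0.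
have eN4 : N ^+ 4 * e = 56^-1 by rewrite /e; field; rewrite gt_eqF.
have N21 : 1 <= N ^+ 2 by rewrite exprn_ege1.
have eN2 : N ^+ 2 * e <= 56^-1.
  rewrite -eN4; apply: ler_wpM2r; [exact: ltW|by apply: ler_weXn2l].
have eN : e <= 56^-1 by apply: le_trans eN2; rewrite ler_peMl // ltW.
(* The raised components are then at most [2 N d = 2 e / 3], and the rank one term is at most
   [2 (2 e / 3)^2 <= e]. *)
exists (e / (3 * N)); split; first by rewrite divr_gt0 // mulr_gt0.
set d := e / (3 * N).
have Nd : N * d = e / 3 by rewrite /d; field; rewrite gt_eqF.
have d0 : 0 <= d by rewrite /d ltW // divr_gt0 // mulr_gt0.
have [r Hr] := metric_small sflat e0.
exists r => x p /Hr {}Hr pd.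
have si2 i j : `|invmx (sigma x) i j| <= 2.
  have [+ _] := Hr i j; have := ler_normD (invmx (sigma x) i j - (i == j)%:R) (i == j)%:R.
  rewrite subrK; case: (i == j); rewrite ?normr0 ?normr1; lra.
have praise i : `|raise sigma x p i| <= 2 * (N * d).
  rewrite mulrCA; apply: norm_sum_le => k; rewrite normrM; exact: ler_pM.
have pnorm : `|norm2_sigma sigma x p| <= 2^-1.
  apply: (@le_trans _ _ (N * (N * (2 * d * d)))).
    by do 2! apply: norm_sum_le => ?; rewrite !normrM; do 2! apply: ler_pM => //; exact: mulr_ge0.
  have -> : N * (N * (2 * d * d)) = 2 * (N * d) ^+ 2 by ring.
  by rewrite Nd; nra.
have gd i j : `|gup sigma x p i j - (i == j)%:R| <= 2 * e.
  rewrite gupE addrAC; apply: le_trans (ler_normD _ _) _.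
  rewrite mulr_natl mulr2n; apply: lerD; first by have [] := Hr i j.
  rewrite normrM normfV normrM.
  have q : 2^-1 <= `|1 - norm2_sigma sigma x p|.
    by apply: le_trans (ler_norm _); have := ler_norm (norm2_sigma sigma x p); lra.
  rewrite ler_pdivrMr; last by apply: lt_le_trans q; rewrite invr_gt0.
  apply: (@le_trans _ _ (2 * (N * d) * (2 * (N * d)))); first exact: ler_pM.
  by rewrite Nd; nra.
pose G i j := \sum_k christoffel sigma x k i j * x 0 k.
have Gd i j : `|G i j| <= 4 * (N ^+ 2 * e).
  have -> : 4 * (N ^+ 2 * e) = 2 * N ^+ 2 * (2 * e) by ring.
  apply: christoffel_le => // k l s t.
  have [_ /(_ s)] := Hr k l; apply: le_trans; rewrite normrM ler_wpM2l //.
  exact: coord_le_enorm.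
split.
  have -> : drift sigma x p - N =
      \sum_i \sum_j ((gup sigma x p i j - (i == j)%:R) * ((i == j)%:R - G i j) - (i == j)%:R * G i j).
    have {1}-> : N = \sum_(i < n) \sum_(j < n) (i == j)%:R.
      rewrite /N -[n in LHS]card_ord -sum1_card natr_sum; apply: eq_bigr => i _.
      rewrite (bigD1 i) //= eqxx big1 ?addr0 // => j ji; by rewrite eq_sym (negbTE ji).
    rewrite /drift -sumrB; apply: eq_bigr => i _; rewrite -sumrB; apply: eq_bigr => j _.
    by rewrite -/(G i j); case: (i == j) => /=; ring.
  apply: (@le_trans _ _ (N * (N * (7 * (N ^+ 2 * e))))); last first.
    by have -> : N * (N * (7 * (N ^+ 2 * e))) = 7 * (N ^+ 4 * e); [ring|rewrite eN4; lra].
  apply: norm_sum_le => i; apply: norm_sum_le => j.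
  apply: le_trans (ler_normB _ _) _; rewrite !normrM.
  have le1 : `|(i == j)%:R| <= 1 :> R by case: (i == j); rewrite ?normr0 ?normr1.
  have E1 : `|(i == j)%:R - G i j| <= 1 + 4 * (N ^+ 2 * e).
    by apply: le_trans (ler_normB _ _) _; apply: lerD.
  have E2 : `|(i == j)%:R| * `|G i j| <= 1 * (4 * (N ^+ 2 * e)) by apply: ler_pM.
  have E3 := ler_pM (normr_ge0 _) (normr_ge0 _) (gd i j) E1.
  have : e <= N ^+ 2 * e by rewrite ler_peMl // ltW.
  nra.
have -> : quad sigma x p - sqn x =
    \sum_i \sum_j ((gup sigma x p i j - (i == j)%:R) * (x 0 i * x 0 j)).
  have -> : sqn x = \sum_i \sum_j (i == j)%:R * (x 0 i * x 0 j).
    apply: eq_bigr => i _; rewrite (bigD1 i) //= eqxx big1 ?addr0 ?mul1r ?expr2 // => j ji.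
    by rewrite eq_sym (negbTE ji) mul0r.
  rewrite /quad -sumrB; apply: eq_bigr => i _; rewrite -sumrB; apply: eq_bigr => j _.
  by rewrite mulrBl.
apply: (@le_trans _ _ (N * (N * (2 * e * sqn x)))); last first.
  have -> : N * (N * (2 * e * sqn x)) = 2 * (N ^+ 2 * e) * sqn x by ring.
  by rewrite ler_wpM2r ?sqn_ge0 //; lra.
apply: norm_sum_le => i; apply: norm_sum_le => j.
rewrite !normrM; apply: ler_pM => //.
rewrite -enorm2 expr2; apply: ler_pM => //; exact: coord_le_enorm.
Qed.

(** * Touching from above by a radial function *)

(** Only times before [t] are compared, because the maximum over [[0, t0]] may be attained at the
    final time. *)
Lemma derive_left_max {R : realType} (f : R -> R) (t d e : R) : 0 < e ->
  is_derive t 1 f d -> (forall s, t - e < s -> s <= t -> f s <= f t) -> 0 <= d.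
Proof.
move=> e0 /is_deriveP fd fmax; rewrite leNgt; apply/negP => d0.
have nd0 : 0 < - d by rewrite oppr_gt0.
have /cvgrPdist_lt /(_ _ nd0) := fd.
rewrite near_withinE => /nbhs_normP[r /= r0 Hr].
have m0 : 0 < Num.min e r by rewrite lt_min e0.
pose h := Num.min e r / 2.
have h0 : 0 < h by rewrite divr_gt0.
have /andP[he hr] : (h < e) && (h < r) by rewrite -lt_min /h; lra.
have := Hr (- h); rewrite /= sub0r opprK gtr0_norm // oppr_eq0 gt_eqF // => /(_ hr isT).
rewrite [_%:A]mulr1 ltr_distlC => /andP[_].
have : f (- h + t) <= f t by apply: fmax; lra.
rewrite -subr_le0 => fle.
have : 0 <= (- h)^-1 * (f (- h + t) - f t).
  by rewrite mulr_le0 // invr_le0 oppr_le0 ltW.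
by rewrite subrr => q0; apply/negP; rewrite -leNgt.
Qed.

Definition dot {R : realType} (n : nat) (x w : 'rV[R]_n) : R := \sum_i x 0 i * w 0 i.

Lemma sqn_line {R : realType} (n : nat) (x w : 'rV[R]_n) (s : R) :
  sqn (s *: w + x) = sqn x + s * (2 * dot x w) + s ^+ 2 * sqn w.
Proof.
rewrite /sqn /dot !mulr_sumr -!big_split /=; apply: eq_bigr => i _.
by rewrite !mxE; ring.
Qed.

(** On the line through [x] in direction [w], [sqn] is the quadratic polynomial [q]; the
    one-dimensional second derivative test gives both claims. The bound [a] keeps [sqn] where [F] is
    differentiable. *)
Lemma radial_touching {R : realType} (n : nat) (f : 'rV[R]_n -> R) (c a : R) (F F1 F2 : R -> R)
    (x : 'rV[R]_n) :
  (forall i y, derivable f y (evec R i)) -> (forall i, continuous (pd f i)) ->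
  (forall i j y, derivable (pd f i) y (evec R j)) -> (forall i j, continuous (pd (pd f i) j)) ->
  (forall s : R, a <= s -> is_derive s 1 F (F1 s)) ->
  (forall s : R, a <= s -> is_derive s 1 F1 (F2 s)) ->
  a < sqn x ->
  (\forall y \near x, c * f y - F (sqn y) <= c * f x - F (sqn x)) ->
  forall w : 'rV[R]_n, c * (\sum_i w 0 i * pd f i x) = 2 * F1 (sqn x) * dot x w /\
    c * (\sum_i \sum_j w 0 i * w 0 j * pd (pd f j) i x) <=
      4 * F2 (sqn x) * dot x w ^+ 2 + 2 * F1 (sqn x) * sqn w.
Proof.
move=> fd fc fdd fcc dF dF1 ax fmax w.
pose l s := s *: w + x.
pose q s := sqn x + s * (2 * dot x w) + s ^+ 2 * sqn w.
pose dq s := 2 * dot x w + 2 * s * sqn w.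
have lc : continuous l.
  move=> s; apply: cvgD; last exact: cvg_cst.
  by apply: cvgZl; exact: cvg_id.
have qd (s : R) : is_derive s 1 q (dq s).
  apply: is_derive_eq.
  by rewrite /dq /= !scaler0 !(add0r, addr0) /GRing.scale /=; ring.
have dqd : is_derive (0 : R) 1 dq (2 * sqn w).
  apply: is_derive_eq.
  by rewrite /= !scaler0 !(add0r, addr0) /GRing.scale /=; ring.
have q0 : q 0 = sqn x by rewrite /q; ring.
have l0 : l 0 = x by rewrite /l scale0r add0r.
have nq : \forall s \near (0 : R), a < q s.
  have qc : {for (0 : R), continuous q}.
    by apply/differentiable_continuous/derivable1_diffP; case: (qd 0).
  by apply: (cvgr_gt _ qc); rewrite q0.
have nl : \forall s \near (0 : R), c * f (l s) - F (sqn (l s)) <= c * f x - F (sqn x).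
  by have lc0 : l s @[s --> (0 : R)] --> x; [rewrite -[X in _ --> X]l0; exact: lc|exact: (lc0 _ fmax)].
have dfl (g : 'rV[R]_n -> R) (s : R) : (forall i y, derivable g y (evec R i)) ->
    (forall i, continuous (pd g i)) ->
    is_derive s 1 (fun s => g (l s)) (\sum_i w 0 i * pd g i (l s)).
  by move=> gd gc; apply: is_derive_line; apply: is_derive_dir.
pose phi s := c * f (l s) - F (q s).
pose dphi s := c * (\sum_i w 0 i * pd f i (l s)) - F1 (q s) * dq s.
have [|||] := @second_derivative_test R phi dphi
  (c * (\sum_i w 0 i * \sum_j w 0 j * pd (pd f i) j x) -
   (F2 (sqn x) * dq 0 * dq 0 + F1 (sqn x) * (2 * sqn w))).
- near=> s; apply: is_deriveB.
    have H := dfl f s fd fc.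
    by apply: is_derive_eq; rewrite ?scaler0 ?addr0.
  have aq : a <= q s by apply/ltW; near: s.
  exact: (@is_derive1_comp R F q s _ _ (dF _ aq)).
- have D1 (i : 'I_n) : is_derive (0 : R) 1 (fun s => pd f i (l s)) (\sum_j w 0 j * pd (pd f i) j x).
    by rewrite -{1}l0; apply: dfl.
  have aq : a <= q 0 by rewrite q0 ltW.
  have D2 : is_derive (0 : R) 1 (fun s => F1 (q s)) (F2 (sqn x) * dq 0).
    by rewrite -q0; exact: (@is_derive1_comp R F1 q 0 _ _ (dF1 _ aq)).
  have D3 : is_derive (0 : R) 1 (fun s => \sum_i w 0 i * pd f i (l s))
      (\sum_i w 0 i * \sum_j w 0 j * pd (pd f i) j x).
    have -> : (fun s => \sum_i w 0 i * pd f i (l s)) = \sum_i (fun s => w 0 i * pd f i (l s)).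
      by apply/funext => s; rewrite fct_sumE.
    by apply: is_derive_sum.
  apply: is_deriveB.
  by apply: is_derive_eq; rewrite /GRing.scale /= q0; ring.
- by near=> s; rewrite /phi q0 l0 /q -sqn_line; near: s.
rewrite /dphi q0 l0 /dq => E1 E2; split.
  by move/eqP: E1; rewrite subr_eq0 => /eqP ->; ring.
move: E2; rewrite subr_le0.
(* The order of the partial derivatives is exchanged by renaming the summation indices, as [w_i w_j]
   is symmetric. *)
have -> : \sum_i w 0 i * \sum_j w 0 j * pd (pd f i) j x =
    \sum_i \sum_j w 0 i * w 0 j * pd (pd f j) i x.
  rewrite exchange_big; apply: eq_bigr => i _ /=; rewrite mulr_sumr; apply: eq_bigr => j _; ring.
by move=> /le_trans; apply; rewrite le_eqVlt; apply/orP; left; apply/eqP; ring.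
Unshelve. all: by end_near.
Qed.

(** * Comparison with radial barriers *)

Lemma norm2_even {R : realType} (n : nat) (sigma : 'rV[R]_n -> 'M[R]_n) (x p : 'rV[R]_n) (c : R) :
  c * c = 1 -> norm2_sigma sigma x (c *: p) = norm2_sigma sigma x p.
Proof.
move=> cc; rewrite /norm2_sigma; apply: eq_bigr => k _; apply: eq_bigr => l _; rewrite !mxE.
transitivity (c * c * (invmx (sigma x) k l * p 0 k * p 0 l)); first by ring.
by rewrite cc mul1r.
Qed.

(** With [c = 1] or [c = -1], this allows [u] and [-u] to be treated at once. *)
Lemma gup_even {R : realType} (n : nat) (sigma : 'rV[R]_n -> 'M[R]_n) (x p : 'rV[R]_n) (c : R) i j :
  c * c = 1 -> gup sigma x (c *: p) i j = gup sigma x p i j.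
Proof.
move=> cc; rewrite !gupE norm2_even //.
have rE k : raise sigma x (c *: p) k = c * raise sigma x p k.
  by rewrite /raise mulr_sumr; apply: eq_bigr => l _; rewrite mxE mulrCA.
by rewrite !rE mulrACA cc mul1r.
Qed.

(** The rank one term is nonnegative because its denominator is positive. *)
Lemma gup_posdef {R : realType} (n : nat) (sigma : 'rV[R]_n -> 'M[R]_n) (x p : 'rV[R]_n) :
  riemannian_metric sigma -> norm2_sigma sigma x p < 1 ->
  posdef (\matrix_(i, j) gup sigma x p i j).
Proof.
move=> rm p1; have [sI pI] := posdef_invmx (metric_posdef x rm).
split.
  apply/matrixP => i j; rewrite !mxE !gupE [raise _ _ _ j * _]mulrC; congr (_ + _).
  by rewrite -[in LHS]sI mxE.
move=> v v0; rewrite mx_quadE.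
have -> : \sum_i \sum_j (\matrix_(i, j) gup sigma x p i j) i j * v 0 i * v 0 j =
  (v *m invmx (sigma x) *m v^T) 0 0 + dot (\row_i raise sigma x p i) v ^+ 2 / (1 - norm2_sigma sigma x p).
  rewrite mx_quadE /dot expr2 !mulr_suml -big_split; apply: eq_bigr => i _ /=.
  rewrite mulr_sumr mulr_suml -big_split; apply: eq_bigr => j _ /=.
  by rewrite !mxE gupE; ring.
by apply: ltr_wpDr; [rewrite divr_ge0 ?sqr_ge0 // subr_ge0 ltW|exact: pI].
Qed.

(** [A] and [B] stand for [F'] and [F''] at [sqn x]. The gradients of [c f] and of the barrier
    agree, hence so do the coefficients and the Christoffel terms; the Hessian difference is
    nonpositive, and [posdef_trace_le0] applies. *)
Lemma operator_touching {R : realType} (n : nat) (sigma : 'rV[R]_n -> 'M[R]_n)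
    (f : 'rV[R]_n -> R) (x : 'rV[R]_n) (c A B : R) :
  riemannian_metric sigma -> c * c = 1 -> norm2_sigma sigma x (grad f x) < 1 ->
  (forall w : 'rV[R]_n, c * (\sum_i w 0 i * pd f i x) = 2 * A * dot x w /\
    c * (\sum_i \sum_j w 0 i * w 0 j * pd (pd f j) i x) <=
      4 * B * dot x w ^+ 2 + 2 * A * sqn w) ->
  grad f x = c *: (2 * A *: x) /\
  c * (\sum_i \sum_j gup sigma x (grad f x) i j * hess_sigma sigma f x i j) <=
    2 * A * drift sigma x (2 * A *: x) + 4 * B * quad sigma x (2 * A *: x).
Proof.
move=> rm cc g1 touch.
have pdE k : c * pd f k x = 2 * A * x 0 k.
  (* Testing with the basis vector [e_k] yields the [k]-th partial derivative. *)
  have [+ _] := touch (delta_mx 0 k).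
  rewrite /dot (bigD1 k) //= [X in _ = _ * X](bigD1 k) //= !big1.
  - by rewrite !mxE !eqxx mul1r mulr1 !addr0.
  - by move=> i ik; rewrite mxE (negbTE ik) andbF mulr0.
  - by move=> i ik; rewrite mxE (negbTE ik) andbF mul0r.
have gE : grad f x = c *: (2 * A *: x).
  by apply/rowP => k; rewrite !mxE -pdE mulrA cc mul1r.
split=> //.
have geq i j : gup sigma x (grad f x) i j = gup sigma x (2 * A *: x) i j.
  by rewrite gE gup_even.
pose g i j := gup sigma x (2 * A *: x) i j.
have pg : posdef (\matrix_(i, j) g i j).
  have := gup_posdef rm g1; congr posdef; apply/matrixP => i j; by rewrite !mxE geq.
(* [H] is the Euclidean Hessian of [c f] minus that of the radial function. *)
pose H : 'M[R]_n := \matrix_(i, j)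
  (c * pd (pd f j) i x - (4 * B * (x 0 i * x 0 j) + 2 * A * (i == j)%:R)).
have Hle (w : 'rV[R]_n) : \sum_i \sum_j w 0 i * w 0 j * H i j <= 0.
  have [_ +] := touch w; rewrite -subr_le0; apply: le_trans.
  rewrite le_eqVlt; apply/orP; left; apply/eqP.
  have -> : dot x w ^+ 2 = \sum_i \sum_j w 0 i * w 0 j * (x 0 i * x 0 j).
    rewrite expr2 /dot mulr_suml; apply: eq_bigr => i _; rewrite mulr_sumr.
    by apply: eq_bigr => j _; ring.
  have -> : sqn w = \sum_i \sum_j w 0 i * w 0 j * (i == j)%:R.
    apply: eq_bigr => i _; rewrite (bigD1 i) //= eqxx mulr1 big1 ?addr0 ?expr2 // => j ji.
    by rewrite eq_sym (negbTE ji) mulr0.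
  rewrite !mulr_sumr -big_split -sumrB; apply: eq_bigr => i _ /=.
  rewrite !mulr_sumr -big_split -sumrB; apply: eq_bigr => j _ /=.
  by rewrite mxE; ring.
have := posdef_trace_le0 pg Hle; rewrite -subr_le0 => tr.
rewrite -subr_le0; apply: le_trans tr.
rewrite subr0 le_eqVlt; apply/orP; left; apply/eqP.
rewrite /drift /quad !mulr_sumr -big_split -sumrB; apply: eq_bigr => i _ /=.
rewrite !mulr_sumr -big_split -sumrB; apply: eq_bigr => j _ /=.
rewrite !mxE geq -/(g i j) /hess_sigma.
have -> : c * (g i j * (pd (pd f j) i x - \sum_k christoffel sigma x k i j * pd f k x)) =
   g i j * (c * pd (pd f j) i x - 2 * A * \sum_k christoffel sigma x k i j * x 0 k).
  have -> : 2 * A * \sum_k christoffel sigma x k i j * x 0 k =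
      c * \sum_k christoffel sigma x k i j * pd f k x.
    rewrite !mulr_sumr; apply: eq_bigr => k _.
    by rewrite mulrCA -pdE; ring.
  ring.
ring.
Qed.

Lemma pair_continuous {R : realType} (n : nat) (t : R) :
  continuous (fun y : 'rV[R]_n => (y, t)).
Proof.
move=> y; apply: (@cvg_pair _ _ _ (nbhs y) (nbhs y) (nbhs t) (nbhs_filter y) (nbhs_filter y)
  (nbhs_filter t) id (fun=> t)).
- exact: cvg_id.
- exact: (@cst_continuous _ _ t y).
Qed.

(** Maximum principle for the barrier [F (sqn x) + K t] on [a <= sqn x]. The operator inequality is
    required only where [c u] exceeds the barrier and the gradient of the barrier satisfies the
    bound with [mu]. For [a < 0] the inner sphere is empty and the region is the whole space. *)
Lemma comparison {R : realType} (n : nat) (sigma : 'rV[R]_n -> 'M[R]_n) (u0 : 'rV[R]_n -> R)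
    (T : \bar R) (u : 'rV[R]_n -> R -> R) (mu c t0 a K : R) (F F1 F2 : R -> R) :
  riemannian_metric sigma -> is_solution sigma u0 T u -> 0 < mu ->
  (forall x t, 0 < t -> (t%:E < T)%E ->
     norm2_sigma sigma x (grad (fun y => u y t) x) <= 1 - mu) ->
  c * c = 1 -> (t0%:E < T)%E ->
  (forall s : R, a <= s -> is_derive s 1 F (F1 s)) ->
  (forall s : R, a <= s -> is_derive s 1 F1 (F2 s)) ->
  (forall x, a <= sqn x -> c * u0 x <= F (sqn x)) ->
  (forall x t, sqn x = a -> 0 < t -> t <= t0 -> c * u x t <= F a + K * t) ->
  (exists b : R, forall x t, b <= sqn x -> 0 < t -> t <= t0 -> c * u x t <= F (sqn x) + K * t) ->
  (forall x t, a < sqn x -> 0 < t -> t <= t0 -> F (sqn x) + K * t < c * u x t ->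
     norm2_sigma sigma x (2 * F1 (sqn x) *: x) <= 1 - mu ->
     2 * F1 (sqn x) * drift sigma x (2 * F1 (sqn x) *: x) +
     4 * F2 (sqn x) * quad sigma x (2 * F1 (sqn x) *: x) < K) ->
  forall x t, a <= sqn x -> 0 < t -> t <= t0 -> c * u x t <= F (sqn x) + K * t.
Proof.
move=> rm [[uC21d uC21c] [uc [u00 ueq]]] mu0 gb cc t0T dF dF1 H0 Ha [b Hb] Hs x1 t1 ax1 t10 t1t0.
rewrite leNgt; apply/negP => bad.
have t00 : 0 < t0 by apply: lt_le_trans t1t0.
pose v (p : 'rV[R]_n * R) := c * u p.1 p.2 - (F (sqn p.1) + K * p.2).
pose A := [set x : 'rV[R]_n | a <= sqn x <= b] `*` `[0, t0].
have cA : compact A.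
  by apply: compact_setX; [exact: annulus_compact|exact: segment_compact].
have x1b : sqn x1 <= b.
  by rewrite leNgt; apply/negP => /ltW bx; move: bad; rewrite ltNge Hb.
have A1 : A (x1, t1).
  by split; rewrite /= ?ax1 //= in_itv /= t1t0 ltW.
have vc : {within A, continuous v}.
  have AT : A `<=` closed_slab T.
    move=> [y s] [_ /=]; rewrite in_itv /= => /andP[s0 st0]; split => //=.
    by apply: le_lt_trans t0T; rewrite lee_fin.
  apply/subspace_continuousP => p Ap; apply: cvgB.
    apply: cvgM; first exact: cvg_cst.
    exact: (subspace_continuousP _ _).1 (continuous_subspaceW AT uc) p Ap.
  apply: cvg_within_filter; apply: cvgD.
    have Fc : {for sqn p.1, continuous F}.
      have ap : a <= sqn p.1 by case: Ap => /= /andP[].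
      by apply/differentiable_continuous/derivable1_diffP; case: (dF _ ap).
    have c1 : {for p, continuous (fun q : 'rV[R]_n * R => sqn q.1)}.
      by apply: (@continuous_comp _ _ _ fst (@sqn R n)); [exact: cvg_fst|exact: sqn_continuous].
    exact: (@continuous_comp _ _ _ (fun q : 'rV[R]_n * R => sqn q.1) F p c1 Fc).
  by apply: cvgM; [exact: cvg_cst|exact: cvg_snd].
have [[x t] Axt vmax] := compact_EVT_max (ex_intro _ _ A1) cA vc.
have vpos : 0 < v (x, t).
  apply: lt_le_trans (vmax (x1, t1) (mem_set A1)).
  by rewrite subr_gt0.
move: Axt; rewrite inE => -[/= /andP[ax xb]]; rewrite in_itv /= => /andP[t_ge0 tt0].
(* The initial, inner and outer conditions in turn exclude a positive maximum at time 0, on the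
   inner sphere and on the outer sphere. *)
have t_gt0 : 0 < t.
  rewrite lt_neqAle t_ge0 andbT; apply/eqP => t0E.
  by move: vpos; rewrite /v /= -t0E u00 mulr0 addr0 subr_gt0 ltNge H0.
have ax' : a < sqn x.
  rewrite lt_neqAle ax andbT; apply/eqP => axE.
  by move: vpos; rewrite /v /= -axE subr_gt0 ltNge Ha.
have xb' : sqn x < b.
  by rewrite ltNge; apply/negP => bx; move: vpos; rewrite /v /= subr_gt0 ltNge Hb.
have tT : (t%:E < T)%E by apply: le_lt_trans t0T; rewrite lee_fin.
have os (y : 'rV[R]_n) : open_slab T (y, t) by [].
pose f y := u y t.
have pairc (y : 'rV[R]_n) : {for y, continuous (fun y : 'rV[R]_n => (y, t))}.
  exact: pair_continuous.
have fd i (y : 'rV[R]_n) : derivable f y (evec R i) by have [+ _] := uC21d _ (os y); exact.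
have fdd i j (y : 'rV[R]_n) : derivable (pd f i) y (evec R j).
  by have [_ [+ _]] := uC21d _ (os y); exact.
have fc i : continuous (pd f i).
  move=> y; have [_ [/(_ i) H _]] := uC21c _ (os y).
  exact: (@continuous_comp _ _ _ (fun y : 'rV[R]_n => (y, t)) _ y (pairc y) H).
have fcc i j : continuous (pd (pd f i) j).
  move=> y; have [_ [_ [/(_ i j) H _]]] := uC21c _ (os y).
  exact: (@continuous_comp _ _ _ (fun y : 'rV[R]_n => (y, t)) _ y (pairc y) H).
have fmax : \forall y \near x, c * f y - F (sqn y) <= c * f x - F (sqn x).
  have n1 : \forall y \near x, a < sqn y by apply: (cvgr_gt _ (@sqn_continuous R n x)).
  have n2 : \forall y \near x, sqn y < b by apply: (cvgr_lt _ (@sqn_continuous R n x)).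
  near=> y.
  have yA : (y, t) \in A.
    rewrite inE; split => /=; last by rewrite in_itv /= t_ge0.
    by apply/andP; split; apply/ltW; [near: y; exact: n1|near: y; exact: n2].
  by have := vmax _ yA; rewrite /v /f /=; lra.
have touch := radial_touching fd fc fdd fcc dF dF1 ax' fmax.
have gx := gb x t t_gt0 tT.
have gx1 : norm2_sigma sigma x (grad f x) < 1 by apply: le_lt_trans gx _; lra.
have [gE op] := operator_touching rm cc gx1 touch.
(* The barrier inherits the gradient bound of the solution at the maximum. *)
have normE : norm2_sigma sigma x (2 * F1 (sqn x) *: x) <= 1 - mu.
  by rewrite -(norm2_even sigma x _ cc) -gE.
have lt1 := Hs x t ax' t_gt0 tt0 _ normE.
have td : is_derive t 1 (fun s => c * u x s - K * s) (c * derive1 (fun s => u x s) t - K).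
  have [_ [_ H]] := uC21d _ (os x).
  have {}H : is_derive t 1 (fun s => u x s) (derive1 (fun s => u x s) t).
    by rewrite derive1E; exact: derivableP.
  by apply: is_derive_eq; rewrite /GRing.scale /=; ring.
have := derive_left_max t_gt0 td; rewrite subrr => tge.
have : 0 <= c * derive1 (fun s => u x s) t - K.
  apply: tge => s s0 st.
  have sA : (x, s) \in A.
    by rewrite inE; split => /=; rewrite ?in_itv /= ?ax ?xb // ltW //= (le_trans st).
  by have := vmax _ sA; rewrite /v /=; lra.
rewrite (ueq x t t_gt0 tT) -/f.
have : F (sqn x) + K * t < c * u x t by move: vpos; rewrite /v subr_gt0.
by move=> /lt1; lra.
Unshelve. all: by end_near.
Qed.

(** * Bounds for solutions *)

Lemma le_small {R : realType} (e0 x y z : R) : 0 < e0 ->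
  (forall e, 0 < e -> e <= e0 -> x <= y + e * z) -> x <= y.
Proof.
move=> e00 H; apply/ler_addgt0Pr => d d0.
have z1 : 0 < `|z| + 1 by rewrite ltr_wpDl.
pose e := Num.min e0 (d / (`|z| + 1)).
have ez : e * (`|z| + 1) <= d by rewrite -ler_pdivlMr // /e ge_min lexx orbT.
have e_gt0 : 0 < e by rewrite lt_min e00 divr_gt0.
apply: (le_trans (H e e_gt0 _)); first by rewrite /e ge_min lexx.
rewrite lerD2l; apply: le_trans ez; rewrite ler_pM2l //.
by apply: le_trans (ler_norm z) _; rewrite lerDl.
Qed.

(** The gradient bound is integrated along the segment from the origin, and [u] is bounded on the
    compact set of points [(0, t)] with [0 <= t <= t0]. *)
Lemma linear_growth {R : realType} (n : nat) (sigma : 'rV[R]_n -> 'M[R]_n) (u0 : 'rV[R]_n -> R)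
    (T : \bar R) (u : 'rV[R]_n -> R -> R) (mu t0 : R) :
  asymptotically_flat sigma -> is_solution sigma u0 T u -> 0 < mu ->
  (forall x t, 0 < t -> (t%:E < T)%E ->
     norm2_sigma sigma x (grad (fun y => u y t) x) <= 1 - mu) ->
  0 < t0 -> (t0%:E < T)%E ->
  exists2 C : R, 0 <= C & forall x t, 0 < t -> t <= t0 -> `|u x t| <= C + C * enorm x.
Proof.
move=> sflat [[uC21d uC21c] [uc _]] mu0 gb t00 t0T.
have [m m0 Hm] := metric_bounds sflat.
(* The annulus with both radii 0 is the origin. *)
pose A := [set x : 'rV[R]_n | 0 <= sqn x <= 0] `*` `[0, t0].
have cA : compact A.
  by apply: compact_setX; [exact: annulus_compact|exact: segment_compact].
have sqn0 : sqn (0 : 'rV[R]_n) = 0.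
  by rewrite /sqn big1 // => i _; rewrite mxE expr0n.
have A0 t : 0 <= t -> t <= t0 -> A (0, t).
  by move=> ? ?; split; rewrite /= ?sqn0 ?lexx //= in_itv /=; apply/andP.
have AT : A `<=` closed_slab T.
  move=> [y s] [_ /=]; rewrite in_itv /= => /andP[s0 st0]; split => //=.
  by apply: le_lt_trans t0T; rewrite lee_fin.
have vc : {within A, continuous (fun p => `|uncurry u p|)}.
  apply/subspace_continuousP => p Ap; apply: cvg_norm.
  exact: (subspace_continuousP _ _).1 (continuous_subspaceW AT uc) p Ap.
have A00 := A0 0 (lexx 0) (ltW t00).
have [p0 _ pmax] := compact_EVT_max (ex_intro _ _ A00) cA vc.
pose D := n%:R * (m + 1) : R.
have D0 : 0 <= D by rewrite mulr_ge0 // addr_ge0.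
exists (`|uncurry u p0| + D); first by rewrite addr_ge0.
move=> x t t_gt0 tt0.
have tT : (t%:E < T)%E by apply: le_lt_trans t0T; rewrite lee_fin.
have os (y : 'rV[R]_n) : open_slab T (y, t) by [].
pose f y := u y t.
have fd i (y : 'rV[R]_n) : derivable f y (evec R i) by have [+ _] := uC21d _ (os y); exact.
have fc i : continuous (pd f i).
  move=> y; have [_ [/(_ i) H _]] := uC21c _ (os y).
  have pairc : {for y, continuous (fun y : 'rV[R]_n => (y, t))} by exact: pair_continuous.
  exact: (@continuous_comp _ _ _ (fun y : 'rV[R]_n => (y, t)) _ y pairc H).
have gd (s : R) : is_derive s 1 (fun s => f (s *: x + 0)) (\sum_i x 0 i * pd f i (s *: x + 0)).
  by apply: is_derive_line; apply: is_derive_dir.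
have [s _] := mean_value 1 gd.
rewrite scale1r scale0r !addr0 mulr1 => E.
have pb i y : `|pd f i y| <= m + 1.
  have := covector_le y (grad f y) i sflat.1; rewrite mxE.
  have := gb y t t_gt0 tT; have [+ _ _] := Hm y i i.
  have := ler_norm (sigma y i i); have := normr_ge0 (pd f i y); rewrite -/f; lra.
have : `|f x - f 0| <= D * enorm x.
  rewrite E /D -mulrA; apply: norm_sum_le => i; rewrite normrM mulrC.
  by apply: ler_pM => //; exact: coord_le_enorm.
have := pmax (0, t) (mem_set (A0 t (ltW t_gt0) tt0)); rewrite /uncurry /= -/(f 0) -/(f x).
have := ler_normD (f x - f 0) (f 0); rewrite subrK.
have := mulr_ge0 (normr_ge0 (u p0.1 p0.2)) (enorm_ge0 x).
by rewrite mulrDl; lra.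
Qed.

Lemma global_bound {R : realType} (n : nat) (sigma : 'rV[R]_n -> 'M[R]_n) (u0 : 'rV[R]_n -> R)
    (T : \bar R) (u : 'rV[R]_n -> R -> R) (mu M c : R) :
  asymptotically_flat sigma -> is_solution sigma u0 T u -> 0 < mu ->
  (forall x t, 0 < t -> (t%:E < T)%E ->
     norm2_sigma sigma x (grad (fun y => u y t) x) <= 1 - mu) ->
  c * c = 1 -> 0 <= M -> (forall x, c * u0 x <= M) ->
  forall x t, 0 < t -> (t%:E < T)%E -> c * u x t <= M.
Proof.
move=> sflat sol mu0 gb cc M0 uM x t0 t00 t0T.
have [C C0 growth] := linear_growth sflat sol mu0 gb t00 t0T.
have [B B0 drB] := drift_bound sflat mu0.
have c1 : `|c| = 1.
  by apply/eqP; rewrite -sqr_norm_eq1 expr2 cc.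
apply: (@le_small R 1 _ _ (sqn x + 2 * (B + 1) * t0)) => // e e0 _.
have -> : M + e * (sqn x + 2 * (B + 1) * t0) = M + e * sqn x + 2 * e * (B + 1) * t0 by ring.
(* With [a = -1] there is no inner sphere. The operator on the barrier is [2 e] times [drift], hence
   at most [2 e B] and less than [K = 2 e (B + 1)]. *)
apply: (@comparison R n sigma u0 T u mu c t0 (-1) (2 * e * (B + 1)) (fun s => M + e * s)
  (fun=> e) (fun=> 0)) => //.
- exact: sflat.1.
- by move=> s _; apply: is_derive_eq; rewrite /GRing.scale /=; ring.
- by move=> y _; rewrite (le_trans (uM y)) // lerDl mulr_ge0 ?sqn_ge0 // ltW.
- by move=> y s ys; have := sqn_ge0 y; rewrite ys; lra.
- pose r := 2 * C / e + 1.
  have r1 : 1 <= r by rewrite lerDr divr_ge0 ?mulr_ge0 // ltW.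
  exists (r ^+ 2) => y s ry s0 st0.
  rewrite -le_enorm ?(le_trans _ r1) // in ry.
  have := growth y s s0 st0; have : c * u y s <= `|u y s|.
    by apply: le_trans (ler_norm _) _; rewrite normrM c1 mul1r.
  have : 0 <= 2 * e * (B + 1) * s by rewrite !mulr_ge0 ?addr_ge0 // ltW.
  rewrite -enorm2; set z := enorm y in ry *.
  have : C + C * z <= e * z ^+ 2.
    have h1 : 2 * C <= e * z.
      by rewrite [e * z]mulrC -ler_pdivrMr //; apply: le_trans _ ry; rewrite lerDl.
    have : 1 <= z by exact: le_trans r1 ry.
    by move=> z1; nra.
  lra.
- move=> y s _ s0 st0 _ ny; rewrite mulr0 mul0r addr0 ltr_pM2l ?mulr_gt0 //.
  by apply: le_lt_trans (drB _ _ ny) _; rewrite ltrDl.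
- by rewrite (le_trans _ (sqn_ge0 x)) // lerN10.
Qed.

(* Any exponent strictly between [- (n - 2) / 2] and [0] would do; [-1/4] works for all [n >= 3]. *)
Definition rpow {R : realType} (s : R) : R := expR (- 4^-1 * ln s).

Lemma rpow_gt0 {R : realType} (s : R) : 0 < rpow s.
Proof. exact: expR_gt0. Qed.

Lemma rpow_decr {R : realType} (s t : R) : 0 < s -> s <= t -> rpow t <= rpow s.
Proof.
move=> s0 st; rewrite ler_expR !mulNr lerN2 ler_pM2l ?invr_gt0 //.
by rewrite ler_ln ?posrE // (lt_le_trans s0).
Qed.

Lemma is_derive_rpow {R : realType} (s : R) : 0 < s ->
  is_derive s 1 (@rpow R) (- 4^-1 * (rpow s / s)).
Proof.
move=> s0; have lnd := is_derive1_ln s0.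
have D : is_derive s 1 (fun s : R => - 4^-1 * ln s) (- 4^-1 * s^-1).
  by apply: is_derive_eq; rewrite /GRing.scale /=; ring.
have := @is_derive1_comp R expR (fun s => - 4^-1 * ln s) s _ _ (is_derive_expR _) D.
by move=> H; apply: is_derive_eq; rewrite /rpow; ring.
Qed.

Lemma rpow_small {R : realType} (e : R) : 0 < e ->
  exists S : R, forall s, 0 < s -> S <= s -> rpow s <= e.
Proof.
move=> e0; exists (expR (- 4 * ln e)) => s s0.
rewrite -{1}(lnK s0) ler_expR => le4.
by rewrite /rpow -[e in _ <= e]lnK // ler_expR; lra.
Qed.

(** The radius is chosen before [T], [u] and [mu]; this uniformity makes the final bound depend on
    [u0] and [sigma] only. *)
Lemma barrier_bound {R : realType} (n : nat) (sigma : 'rV[R]_n -> 'M[R]_n) (u0 : 'rV[R]_n -> R)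
    (M eta : R) :
  (3 <= n)%N -> asymptotically_flat sigma -> vanishes_at_infinity u0 -> 0 <= M ->
  (forall x, `|u0 x| <= M) -> 0 < eta ->
  exists r : R, forall (T : \bar R) (u : 'rV[R]_n -> R -> R) (mu : R),
    is_solution sigma u0 T u -> 0 < mu ->
    (forall x t, 0 < t -> (t%:E < T)%E ->
       norm2_sigma sigma x (grad (fun y => u y t) x) <= 1 - mu) ->
    forall c x t, c * c = 1 -> r <= enorm x -> 0 < t -> (t%:E < T)%E -> c * u x t <= eta.
Proof.
move=> n3 sflat u0v M0 uM eta0.
have [d [d0 [r1 asym]]] := drift_quad_asymptotics (ltnW (ltnW n3)) sflat.
have eta2 : 0 < eta / 2 by rewrite divr_gt0.
have [r2 u0small] := u0v _ eta2.
(* Beyond [r] the asymptotics hold, [|u0| < eta / 2], and the gradient of [A |x|^(-1/2)] is at most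
   [d / 2]. *)
pose r := 1 + `|r1| + `|r2| + M / d.
have Md0 : 0 <= M / d by rewrite divr_ge0 // ltW.
have r_ge1 : 1 <= r by rewrite /r -!addrA lerDl !addr_ge0.
have r_gt0 : 0 < r by exact: lt_le_trans r_ge1.
have rr1 : r1 <= r by rewrite /r; have := ler_norm r1; have := normr_ge0 r2; lra.
have rr2 : r2 <= r by rewrite /r; have := ler_norm r2; have := normr_ge0 r1; lra.
have rMd : M <= r * d.
  rewrite -ler_pdivrMr //; rewrite /r; have := normr_ge0 r1; have := normr_ge0 r2; lra.
pose a := r ^+ 2.
have a0 : 0 < a by exact: exprn_gt0.
(* With this [A] the barrier is at least [M] on the inner sphere, where [global_bound] gives
   [c u <= M]. *)
pose A := M / rpow a.
have A0 : 0 <= A by rewrite divr_ge0 // ltW // rpow_gt0.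
have AM s : a <= s -> A * rpow s <= M.
  move=> as_; have : rpow s <= rpow a by exact: rpow_decr.
  by rewrite /A -mulrA => le; apply: ler_piMr => //; rewrite ler_pdivrMl ?rpow_gt0 // mulr1.
(* [A + 1] replaces [A], which may be 0; beyond [S] the term [A rpow] is at most [eta / 2]. *)
have A1 : 0 < 2 * (A + 1) by rewrite mulr_gt0 // ltr_wpDl.
have [S Ssmall] := rpow_small (divr_gt0 eta0 A1).
exists (Num.max r S) => T u mu sol mu0 gb c x t0 cc; rewrite ge_max => /andP[rx Sx] t00 t0T.
have c1 : `|c| = 1 by apply/eqP; rewrite -sqr_norm_eq1 expr2 cc.
have cle (y : R) : c * y <= `|y| by apply: le_trans (ler_norm _) _; rewrite normrM c1 mul1r.
have cuM y t : 0 < t -> (t%:E < T)%E -> c * u y t <= M.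
  by apply: (global_bound sflat sol mu0 gb cc M0) => z; apply: le_trans (cle _) (uM z).
pose N : R := n%:R.
have N3 : 3 <= N by rewrite /N ler_nat.
(* The restriction on [e] gives [16 e M <= d^2]. The factor [2 N + 3] leaves room above
   [2 drift <= 2 N + 1/4]. *)
suff main e : 0 < e -> e <= d ^+ 2 / (16 * (M + 1)) ->
    c * u x t0 <= eta / 2 + A * rpow (sqn x) + e * (sqn x + (2 * N + 3) * t0).
  apply: (@le_trans _ _ (eta / 2 + A * rpow (sqn x))).
    apply: (le_small _ main); rewrite divr_gt0 ?exprn_gt0 ?mulr_gt0 // ltr_wpDl //.
  have x1 : 1 <= enorm x by exact: le_trans r_ge1 rx.
  have : rpow (sqn x) <= eta / (2 * (A + 1)).
    rewrite -enorm2; apply: Ssmall; first by rewrite exprn_gt0 // (lt_le_trans ltr01).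
    by apply: le_trans Sx _; rewrite expr2 ler_peMl ?enorm_ge0.
  rewrite ler_pdivlMr // => H; have := rpow_gt0 (sqn x); nra.
move=> e0 ed.
have -> : eta / 2 + A * rpow (sqn x) + e * (sqn x + (2 * N + 3) * t0) =
  eta / 2 + A * rpow (sqn x) + e * sqn x + e * (2 * N + 3) * t0 by ring.
have eM : 16 * e * M <= d ^+ 2.
  move: ed; rewrite ler_pdivlMr ?mulr_gt0 // ?ltr_wpDl //; nra.
have as0 s : a <= s -> 0 < s by exact: lt_le_trans.
apply: (@comparison R n sigma u0 T u mu c t0 a (e * (2 * N + 3))
  (fun s => eta / 2 + A * rpow s + e * s)
  (fun s => - (A / 4) * (rpow s / s) + e)
  (fun s => (5 * A / 16) * (rpow s / s ^+ 2)) sflat.1 sol mu0 gb cc t0T _ _ _ _ _ _ x t0 _ t00 (lexx t0)).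
- move=> s /as0 s0; have H := is_derive_rpow s0.
  by apply: is_derive_eq; rewrite /GRing.scale /=; field; rewrite gt_eqF.
- move=> s /as0 s0; have H := is_derive_rpow s0.
  have V : is_derive s 1 (fun s : R => s^-1) (- s ^- 2).
    split; first by apply: derivableV; rewrite ?gt_eqF.
    by rewrite (@deriveV _ _ id) ?gt_eqF // derive_id /GRing.scale /= mulr1.
  have H2 : is_derive s 1 (fun s : R => rpow s * s^-1) (- 5 / 4 * (rpow s / s ^+ 2)).
    by apply: is_derive_eq; rewrite /GRing.scale /=; field; rewrite gt_eqF.
  by apply: is_derive_eq; rewrite /GRing.scale /=; field; rewrite gt_eqF.
- move=> y ay.
  have ry : r <= enorm y by rewrite le_enorm // ltW.
  have := u0small y (le_trans rr2 ry); have := cle (u0 y).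
  have : 0 <= A * rpow (sqn y) by rewrite mulr_ge0 // ltW // rpow_gt0.
  have : 0 <= e * sqn y by rewrite mulr_ge0 ?sqn_ge0 // ltW.
  lra.
- move=> y t _ t_gt0 tt0.
  have tT : (t%:E < T)%E by apply: le_lt_trans t0T; rewrite lee_fin.
  have := cuM y t t_gt0 tT.
  have -> : A * rpow a = M by rewrite /A divfK // gt_eqF // rpow_gt0.
  have : 0 <= e * a by rewrite mulr_ge0 // ltW.
  have : 0 <= e * (2 * N + 3) * t by rewrite !mulr_ge0 ?addr_ge0 ?mulr_ge0 //; lra.
  lra.
- exists (Num.max a (M / e)) => y t; rewrite ge_max => /andP[ay yMe] t_gt0 tt0.
  have tT : (t%:E < T)%E by apply: le_lt_trans t0T; rewrite lee_fin.
  have := cuM y t t_gt0 tT.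
  have : M <= e * sqn y by rewrite mulrC -ler_pdivrMr.
  have : 0 <= A * rpow (sqn y) by rewrite mulr_ge0 // ltW // rpow_gt0.
  have : 0 <= e * (2 * N + 3) * t by rewrite !mulr_ge0 ?addr_ge0 ?mulr_ge0 //; lra.
  lra.
- move=> y t ay t_gt0 tt0 vpos _.
  have tT : (t%:E < T)%E by apply: le_lt_trans t0T; rewrite lee_fin.
  set s := sqn y in ay vpos *.
  have s0 : 0 < s by apply: as0; exact: ltW.
  have ry : r <= enorm y by rewrite le_enorm // ltW.
  have y0 : 0 < enorm y by exact: lt_le_trans ry.
  have h0 : 0 <= A * rpow s by rewrite mulr_ge0 // ltW // rpow_gt0.
  have hM : A * rpow s <= M by apply: AM; exact: ltW.
  (* At such a point the barrier lies below [c u <= M], and its other terms are nonnegative. *)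
  have es : e * s <= M.
    have := cuM y t t_gt0 tT.
    have : 0 <= e * (2 * N + 3) * t by rewrite !mulr_ge0 ?addr_ge0 ?mulr_ge0 //; lra.
    lra.
  pose k := A * rpow s / s.
  have k0 : 0 <= k by rewrite divr_ge0 // ltW.
  set F1 := - (A / 4) * (rpow s / s) + e.
  (* Both parts of the gradient are at most [d / 2]: for the power by the choice of [r], for the
     quadratic term because [(4 e |y|)^2 = 16 e (e s) <= 16 e M <= d^2]. *)
  have pd i : `|(2 * F1 *: y) 0 i| <= d.
    rewrite mxE normrM.
    apply: (@le_trans _ _ (`|2 * F1| * enorm y)); first by rewrite ler_wpM2l // coord_le_enorm.
    have e1 : A * rpow s / s * enorm y <= d.
      have sE : s = enorm y * enorm y by rewrite /s -enorm2 expr2.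
      rewrite [X in _ / X]sE invfM mulrA mulfVK ?gt_eqF // ler_pdivrMr // [d * _]mulrC.
      by apply: le_trans hM (le_trans rMd _); rewrite ler_wpM2r // ltW.
    have e2 : 4 * (e * enorm y) <= d.
      have ez0 : 0 <= 4 * (e * enorm y) by rewrite !mulr_ge0 ?enorm_ge0 // ltW.
      rewrite -(ler_pXn2r (n := 2)) ?nnegrE //; last exact: ltW.
      rewrite exprMn exprMn enorm2 -/s.
      have : e * (e * s) <= e * M by rewrite ler_pM2l.
      lra.
    have -> : 2 * F1 = - (2^-1 * (A * rpow s / s)) + 2 * e by rewrite /F1; field; rewrite gt_eqF.
    have : `|- (2^-1 * (A * rpow s / s)) + 2 * e| <= 2^-1 * (A * rpow s / s) + 2 * e.
      rewrite -/k ler_norml; apply/andP; split; lra.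
    move=> H; apply: (le_trans (ler_wpM2r (ltW y0) H)); rewrite mulrDl; lra.
  have [dn qs] := asym y _ (le_trans rr1 ry) pd.
  move: dn qs; set P := drift _ _ _; set Q := quad _ _ _ => dn qs.
  (* As [P >= 3 - 1/8] and [Q / s <= 9/8], the bracket multiplying [k] is at most
     [-23/16 + 45/32 = -1/32]. This is where [n >= 3] enters. *)
  have -> : 2 * F1 * P + 4 * (5 * A / 16 * (rpow s / s ^+ 2)) * Q =
    k * (- P / 2 + 5 / 4 * (Q / s)) + e * (2 * P).
    by rewrite /k /F1; field; rewrite gt_eqF.
  have Qs : Q / s <= 9 / 8.
    rewrite ler_pdivrMr //; move: qs; rewrite -/s ler_norml => /andP[_]; lra.
  move: dn; rewrite -/N ler_norml => /andP[P1 P2].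
  have : k * (- P / 2 + 5 / 4 * (Q / s)) <= 0 by apply: mulr_ge0_le0 => //; lra.
  have : e * (2 * P) < e * (2 * N + 3) by rewrite ltr_pM2l //; lra.
  lra.
- by rewrite /a -le_enorm // ltW.
Qed.

(* The envelope of all solutions *)
Local Close Scope classical_set_scope.
Unset Implicit Arguments. Set Strict Implicit. Set Printing Implicit Defensive.

Theorem theorem5p4 (R : realType) (n : nat) (hn : (3 <= n)%N)
    (sigma : 'rV[R]_n -> 'M[R]_n) (hsigma : asymptotically_flat sigma)
    (u0 : 'rV[R]_n -> R) (hu0L : lipschitz_fun u0)
    (hu0s : uniformly_spacelike sigma u0)
    (hu0inf : vanishes_at_infinity u0) :
  (forall (T : \bar R) (u : 'rV[R]_n -> R -> R) (mu : R),
     (0 < T)%E -> is_solution sigma u0 T u -> 0 < mu ->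
     (forall x t, 0 < t -> (t%:E < T)%E ->
        norm2_sigma sigma x (grad (fun y => u y t) x) <= 1 - mu) ->
     forall t, 0 < t -> (t%:E < T)%E -> vanishes_at_infinity (fun x => u x t)) /\
  exists b : 'rV[R]_n -> R,
    (forall x, 0 <= b x) /\ vanishes_at_infinity b /\
    forall (T : \bar R) (u : 'rV[R]_n -> R -> R) (mu : R),
      (0 < T)%E -> is_solution sigma u0 T u -> 0 < mu ->
      (forall x t, 0 < t -> (t%:E < T)%E ->
         norm2_sigma sigma x (grad (fun y => u y t) x) <= 1 - mu) ->
      forall x t, 0 < t -> (t%:E < T)%E -> `|u x t| <= b x.
Proof.
have [M M0 uM] := vanishing_bounded hu0L hu0inf.
pose sol (T : \bar R) (u : 'rV[R]_n -> R -> R) (mu : R) :=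
  [/\ is_solution sigma u0 T u, 0 < mu & forall x t, 0 < t -> (t%:E < T)%E ->
    norm2_sigma sigma x (grad (fun y => u y t) x) <= 1 - mu].
have abs_le (y B : R) : (forall c, c * c = 1 -> c * y <= B) -> `|y| <= B.
  move=> H; have := H 1 (mulr1 1); have := H (-1) (ltac:(by rewrite mulrNN mulr1)).
  by rewrite mul1r mulN1r ler_norml lerNl => -> ->.
have solM T u mu x t : sol T u mu -> 0 < t -> (t%:E < T)%E -> `|u x t| <= M.
  move=> [su mu0 gb] t0 tT; apply: abs_le => c cc.
  apply: (global_bound hsigma su mu0 gb cc M0) => // y.
  apply: le_trans (uM y); apply: le_trans (ler_norm _) _.
  have c1 : `|c| = 1 by apply/eqP; rewrite -sqr_norm_eq1 expr2 cc.
  by rewrite normrM c1 mul1r.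
(* The value 0 keeps the set nonempty and the supremum nonnegative even if no solution exists.
   Quantifying over [mu] as well makes [b] independent of it. *)
pose E x := [set z | z = 0 \/ exists T u mu t,
  [/\ sol T u mu, 0 < t, (t%:E < T)%E & z = `|u x t|]]%classic.
pose b x := sup (E x).
have E0 x : (E x !=set0)%classic by exists 0; left.
have Eb x : has_sup (E x).
  split=> //; exists M => z [->//|[T [u [mu [t [su t0 tT ->]]]]]].
  exact: solM su t0 tT.
have b0 x : 0 <= b x by apply: sup_upper_bound => //; left.
have ub T u mu x t : sol T u mu -> 0 < t -> (t%:E < T)%E -> `|u x t| <= b x.
  by move=> su t0 tT; apply: sup_upper_bound => //; right; exists T, u, mu, t.
have bv : vanishes_at_infinity b.
  (* A supremum preserves only weak bounds, hence [eps / 2]. *)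
  move=> eps eps0; have eps2 : 0 < eps / 2 by rewrite divr_gt0.
  have [r Hr] := barrier_bound hn hsigma hu0inf M0 uM eps2.
  exists r => x rx; rewrite ger0_norm //.
  apply: (@le_lt_trans _ _ (eps / 2)); last by lra.
  apply: ge_sup => // z [->|[T [u [mu [t [[su mu0 gb] t0 tT ->]]]]]]; first exact: ltW.
  by apply: abs_le => c cc; exact: (Hr T u mu su mu0 gb).
split.
  move=> T u mu _ su mu0 gb t t0 tT eps /bv[r Hr]; exists r => x /Hr.
  rewrite ger0_norm //; apply: le_lt_trans.
  exact: (ub T u mu).
by exists b; split=> //; split=> // T u mu _ su mu0 gb x t; exact: (ub T u mu).
Qed.
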